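(* Let $m \geq 1$ be an integer. Then, as $n \to \infty$, $$\mathbb{E}_m(n) \sim \frac{6^{m/2}}{2^m \pi^m}\, n^{m/2} \log^m\left(\frac{\sqrt{6n}}{\pi}\right),$$ where $\mathbb{E}_m(n) = \frac{1}{p(n)}\sum_{\lambda \vdash n} a(\lambda)^m$ is the $m$-th moment of the alternating sum statistic $a(\lambda)$ over the partitions $\lambda$ of $n$.
   Context: A partition of a non-negative integer $n$ is a non-increasing list $\lambda = (\lambda_1, \lambda_2, \dots, \lambda_\ell)$ of positive integers with $\lambda_1 + \cdots + \lambda_\ell = n$; write $\lambda \vdash n$ and let $\ell(\lambda) = \ell$ be the number of parts. Set $\lambda_j = 0$ for $j > \ell(\lambda)$. The number of partitions of $n$ is denoted $p(n)$. The alternating sum of $\lambda$ is $$a(\lambda) := \lambda_1 - \lambda_2 + \lambda_3 - \cdots = \sum_{j \geq 1} (-1)^{j+1} \lambda_j.$$ For integers $m \geq 1$, $n \geq 0$, define $A_m(n) := \sum_{\lambda \vdash n} a(\lambda)^m$ and $\mathbb{E}_m(n) := A_m(n)/p(n)$. Here $f(n) \sim g(n)$ means $f(n)/g(n) \to 1$, and $\log^m(x) = (\log x)^m$. *)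

(* Defs.v *)
From HB Require Import structures.
From mathcomp Require Import all_boot all_order all_algebra.
From mathcomp Require Import all_classical all_reals all_analysis.

Set Implicit Arguments.
Unset Strict Implicit.
Unset Printing Implicit Defensive.

Import Order.TTheory GRing.Theory Num.Theory.
Import numFieldNormedType.Exports.
Local Open Scope classical_set_scope.
Local Open Scope ring_scope.

Definition is_intpart (n : nat) (s : seq nat) : bool :=
  [&& sorted geq s, all (leq 1%N) s & sumn s == n].

Record intpart (n : nat) := IntPart {
  parts :> seq nat;
  partsP : is_intpart n parts }.

HB.instance Definition _ n := [isSub for @parts n].
HB.instance Definition _ n := [Countable of intpart n by <:].

(* A partition of n has at most n parts, each at most n. *)
Definition intpart_enum n : seq (intpart n) :=
  undup (pmap insub [seq map val (val b) | b : {bseq n of 'I_n.+1}]).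

Lemma size_intpart s : all (leq 1%N) s -> (size s <= sumn s)%N.
Proof.
by elim: s => //= x s IH /andP[x0 /IH h]; rewrite -add1n leq_add.
Qed.

Lemma mem_leq_sumn (s : seq nat) x : x \in s -> (x <= sumn s)%N.
Proof.
elim: s => //= y s IH; rewrite inE => /orP[/eqP ->|/IH h].
  exact: leq_addr.
by rewrite (leq_trans h) ?leq_addl.
Qed.

Lemma intpart_enumP n : Finite.axiom (intpart_enum n).
Proof.
apply: Finite.uniq_enumP; first exact: undup_uniq.
move=> l; rewrite mem_undup mem_pmap_sub /= inE.
have /and3P[_ pos /eqP sum] := partsP l.
have sz : (size (map (@inord n) l) <= n)%N.
  by rewrite size_map -[leqRHS]sum size_intpart.
apply/mapP; exists (Bseq sz); first by rewrite mem_enum.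
rewrite /= -map_comp map_id_in // => x xl /=.
by rewrite inordK // ltnS -[leqRHS]sum mem_leq_sumn.
Qed.

HB.instance Definition _ n := fintype.isFinite.Build (intpart n) (@intpart_enumP n).

(* Indices start at 0, so part number j + 1 is [nth 0 l j] and carries the
   sign (-1) ^ j. *)
Definition altsum (n : nat) (l : intpart n) : int :=
  \sum_(j < size l) (-1) ^+ j * (nth 0%N l j)%:Z.

Definition npart (n : nat) : nat := #|{: intpart n}|.

Definition altsum_power_sum (m n : nat) : int :=
  \sum_(l : intpart n) altsum l ^+ m.

Definition altsum_moment (R : realType) (m n : nat) : R :=
  (altsum_power_sum m n)%:~R / (npart n)%:R.

Definition asymp_equiv (R : realType) (f g : nat -> R) : Prop :=
  (f n / g n) @[n --> \oo] --> (1 : R).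

(* Main.v *)
Require Import Defs.
From mathcomp Require Import all_boot all_order all_algebra.
From mathcomp Require Import all_classical all_reals all_analysis.
From mathcomp Require Import zify ring lra.
Import Order.TTheory GRing.Theory Num.Theory.
Import numFieldNormedType.Exports.
Local Open Scope classical_set_scope.
Local Open Scope ring_scope.

Set Implicit Arguments.
Unset Strict Implicit.
Unset Printing Implicit Defensive.

(** Conjugation turns the alternating sum into the number of odd parts. Counting
    pairs (partition, group of j copies of its part k) and removing the j copies
    expresses every moment through the numbers p(n - jk).

    Put Q(n) = sum_(i < n) p(i) and T(n) = sum_(1 <= i <= n) Q(i). As p is monotone,
    the identity n p(n) = sum_(j,k) k p(n - jk) gives n p(n) ~ zeta(2) T(n). So
    w = T / Q satisfies the discrete Riccati recursion
    w(n+1) = 1 + w(n) / (1 + a(n) w(n)) with a(n) ~ pi^2 / (6 n), whose solutions are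
    all attracted to sqrt(6 n) / pi; hence Q(n) / p(n) ~ sqrt(6 n) / pi, with no need
    for the Hardy-Ramanujan asymptotics of p.

    The mean number of parts equal to k lies between Q(n) / (k p(n)) - 1 and
    Q(n) / (k p(n)), and the parts larger than sqrt n contribute O(sqrt n) in mean.
    This yields the first moment. Jensen's inequality bounds the m-th moment from
    below. The upper bound is an induction on m based on
    (x + j)^m <= (1 + d)^m x^m + (1 + 1/d)^m j^m: the powers of j contribute less
    by a factor log^m n. *)

(** * Partitions and the multiplicities of their conjugates *)

Section Partitions.
Local Open Scope nat_scope.

(** The zeros of an antitone sequence come last, so dropping them truncates the list without
    shifting any index. *)
Lemma filter_mkseq_antitone (g : nat -> nat) (N : nat) :
  (forall i, g i.+1 <= g i) ->
  exists2 M, M <= N &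
    [seq x <- mkseq g N | 0 < x] = mkseq g M /\
    (forall i, (M <= i < N) -> g i = 0).
Proof.
move=> gd; elim: N => [|N [M MN [IH1 IH2]]].
  by exists 0 => //; split => // i; rewrite ltn0 andbF.
rewrite mkseqS filter_rcons.
case: (posnP (g N)) => [gN0|gN].
  exists M; first exact: leqW.
  split => // i /andP[Mi]; rewrite ltnS leq_eqVlt => /orP[/eqP->//|iN].
  by apply: IH2; rewrite Mi.
exists N.+1 => //; split; last by move=> i; lia.
have gpos i : i < N -> 0 < g i.
  move=> iN; apply: leq_trans gN _.
  elim: (N) iN => // k IHk; rewrite ltnS leq_eqVlt => /orP[/eqP->//|ik].
  exact: leq_trans (gd _) (IHk ik).
rewrite mkseqS; congr rcons; apply/all_filterP/allP => x /mapP[i].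
by rewrite mem_iota add0n => /andP[_ /gpos ?] ->.
Qed.

Definition part (n : nat) (l : intpart n) (i : nat) : nat := nth 0 l i.

Lemma part_antitone n (l : intpart n) i : part l i.+1 <= part l i.
Proof.
rewrite /part; have /and3P[srt _ _] := partsP l.
case: (ltnP i.+1 (size l)) => [il|/(nth_default 0) -> //].
move: srt => /(sortedP 0) /(_ i il) /=; lia.
Qed.

Lemma part_homo n (l : intpart n) i j : i <= j -> part l j <= part l i.
Proof.
elim: j => [|j IH]; first by rewrite leqn0 => /eqP->.
rewrite leq_eqVlt => /orP[/eqP->//|ij].
exact: leq_trans (part_antitone l j) (IH ij).
Qed.

Lemma part_eq0 n (l : intpart n) i : n <= i -> part l i = 0.
Proof.
move=> ni; rewrite /part nth_default // (leq_trans _ ni) //.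
have /and3P[_ pos /eqP sum] := partsP l.
by rewrite -[leqRHS]sum size_intpart.
Qed.

Lemma sum_part n (l : intpart n) M : n <= M -> \sum_(i < M) part l i = n.
Proof.
move=> nM; have /and3P[_ pos /eqP sum] := partsP l.
have sn : size l <= n by rewrite -[leqRHS]sum size_intpart.
rewrite -[RHS]sum sumnE (big_nth 0) -(subnKC (leq_trans sn nM)) big_mkord.
rewrite big_split_ord /= [X in _ + X]big1 ?addn0 // => i _.
by rewrite /part nth_default // leq_addr.
Qed.

Lemma part_inj n (l l' : intpart n) : part l =1 part l' -> l = l'.
Proof.
move=> e; apply/val_inj => /=.
have le (s s' : seq nat) : all (leq 1) s -> (forall i, nth 0 s i = nth 0 s' i) ->
    size s <= size s'.
  move=> /all_nthP pos h; rewrite leqNgt; apply/negP => lt.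
  by have := pos 0 _ lt; rewrite h nth_default.
have /and3P[_ pos _] := partsP l; have /and3P[_ pos' _] := partsP l'.
apply: (@eq_from_nth _ 0) => [|i _]; last exact: e.
by apply/eqP; rewrite eqn_leq; apply/andP; split; apply: le => // i;
  rewrite -?/(part l i) -?/(part l' i) e.
Qed.

Lemma ones_intpart n : is_intpart n (nseq n 1).
Proof.
apply/and3P; split; first by case: n => // n; elim: n => // n /= ->.
  by rewrite all_nseq orbT.
by rewrite sumn_nseq mul1n.
Qed.

(** The all-ones partition is a default value; [part_of_fun] gives conditions under which it is not
    taken. *)
Definition of_fun (n : nat) (g : nat -> nat) : intpart n :=
  insubd (IntPart (ones_intpart n)) [seq x <- mkseq g n | 0 < x].

(** The support bound [M] may exceed the total [n]: for [del_rows] the total is [n - k * j], but the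
    rows are only known to vanish from [n] on. *)
Lemma part_of_fun n M (g : nat -> nat) :
  (forall i, g i.+1 <= g i) -> (forall i, M <= i -> g i = 0) -> n <= M ->
  \sum_(i < M) g i = n -> part (of_fun n g) =1 g.
Proof.
move=> gd gM nM gs.
have gmono i j : i <= j -> g j <= g i.
  elim: j => [|j IH]; first by rewrite leqn0 => /eqP->.
  by rewrite leq_eqVlt => /orP[/eqP->//|/IH]; apply: leq_trans.
(* A positive value at an index [i >= n] would force [i.+1] positive values, hence a total above
   [n]. *)
have g0 i : n <= i -> g i = 0.
  move=> ni; case: (ltnP i M) => [iM|/gM//].
  case: (posnP (g i)) => // gi; exfalso.
  suff : i.+1 <= \sum_(i < M) g i by rewrite gs; lia.
  rewrite -(subnKC iM) big_split_ord /=; apply: leq_trans (leq_addr _ _).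
  rewrite -[leqLHS]card_ord -sum1_card; apply: leq_sum => j _.
  by apply: leq_trans gi _; apply: gmono; rewrite -ltnS ltn_ord.
have {gM}gs : \sum_(i < n) g i = n.
  rewrite -[RHS]gs -(subnKC nM) big_split_ord /= [X in _ + X]big1 ?addn0 //.
  by move=> i _; rewrite g0 ?leq_addr.
move=> i; rewrite /part /of_fun val_insubd.
have [K Kn [E gK]] := filter_mkseq_antitone n gd.
have -> : is_intpart n [seq x <- mkseq g n | 0 < x].
  apply/and3P; split.
  - rewrite E; apply/(sortedP 0) => j; rewrite size_mkseq => jK /=.
    by rewrite /geq /= nth_mkseq // nth_mkseq ?(ltnW jK) // gd.
  - exact: filter_all.
  rewrite E sumnE big_map -[K]subn0 -/(index_iota _ _) big_mkord.
  rewrite -[X in _ == X]gs -(subnKC Kn) big_split_ord /=.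
  rewrite [X in _ == _ + X]big1 ?addn0 ?subn0 // => j _.
  by apply: gK; have := ltn_ord j; lia.
rewrite E; case: (ltnP i K) => iK; first by rewrite nth_mkseq.
rewrite nth_default ?size_mkseq //.
by case: (ltnP i n) => ni; [rewrite gK ?iK|rewrite g0].
Qed.

(* [cmult l k] is the multiplicity of [k] in the conjugate of [l], so that
   [l] is determined by an arbitrary sequence of multiplicities and the
   alternating sum counts the odd parts of the conjugate. *)
Definition cmult (n : nat) (l : intpart n) (k : nat) : nat :=
  part l k.-1 - part l k.

(** Summation by parts, with [M * g M] as boundary term. *)
Lemma sum_mul_sub (g : nat -> nat) (M : nat) : (forall i, g i.+1 <= g i) ->
  \sum_(i < M) i.+1 * (g i - g i.+1) + M * g M = \sum_(i < M) g i.
Proof.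
move=> gd; elim: M => [|M IH]; first by rewrite !big_ord0.
by rewrite !big_ord_recr /= -IH -addnA -mulnDr subnK // mulSn -addnA (addnC (g M)).
Qed.

Lemma sum_cmult n (l : intpart n) : \sum_(1 <= k < n.+1) k * cmult l k = n.
Proof.
rewrite big_add1 /= big_mkord -[RHS](sum_part l (leqnn n)).
by rewrite -(sum_mul_sub _ (part_antitone l)) part_eq0 // muln0 addn0.
Qed.

Lemma cmult_le n (l : intpart n) k : 0 < k -> k * cmult l k <= n.
Proof.
move=> k0; case: (leqP k n) => kn; last first.
  by rewrite /cmult part_eq0 ?sub0n ?muln0 //; lia.
rewrite -[leqRHS](sum_cmult l) (bigD1_seq k) ?iota_uniq //= ?leq_addr //.
by rewrite mem_index_iota k0 ltnS.
Qed.

(** Lengthening the first [k] rows by [j] inserts [j] parts equal to [k] into the conjugate;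
    [del_rows] removes them again. *)
Definition add_rows (n k j : nat) (l : intpart (n - k * j)) : intpart n :=
  of_fun n (fun i => part l i + j * (i < k)).

Definition del_rows (n k j : nat) (l : intpart n) : intpart (n - k * j) :=
  of_fun (n - k * j) (fun i => part l i - j * (i < k)).

Lemma sum_ltn n k : k <= n -> \sum_(i < n) (i < k : nat) = k.
Proof.
move=> kn; rewrite -(subnKC kn) big_split_ord /= [X in _ + X]big1 ?addn0.
  rewrite (eq_bigr (fun=> 1)) ?sum1_card ?card_ord // => i _.
  by rewrite ltn_ord.
by move=> i _; rewrite ltnNge leq_addr.
Qed.

Lemma part_add_rows n k j (l : intpart (n - k * j)) : 0 < j -> k * j <= n ->
  part (add_rows l) =1 (fun i => part l i + j * (i < k)).
Proof.
move=> j0 kj; apply: (@part_of_fun _ n) => // [i|i ni|].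
- have := part_antitone l i; case: (ltnP i k); case: (ltnP i.+1 k); nia.
- by rewrite part_eq0; [case: (ltnP i k); nia|lia].
by rewrite big_split /= sum_part ?leq_subr // -big_distrr /= sum_ltn; nia.
Qed.

Lemma part_del_rows n k j (l : intpart n) : 0 < k -> 0 < j -> j <= cmult l k ->
  part (del_rows k j l) =1 (fun i => part l i - j * (i < k)).
Proof.
move=> k0 j0 jk; have kc := cmult_le l k0.
have kn : k <= n by nia.
have ge i : i < k -> j <= part l i.
  move=> ik; apply: leq_trans jk _; rewrite /cmult; apply: leq_trans (leq_subr _ _) _.
  by apply: part_homo; lia.
apply: (@part_of_fun _ n) => [i|i ni||].
- have := part_antitone l i; move: jk; rewrite /cmult.
  case: (ltnP i k) => ik; case: (ltnP i.+1 k) => ik'; first lia.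
  - by have -> : k.-1 = i by [lia]; have -> : k = i.+1 by [lia]; lia.
  - lia.
  - lia.
- by rewrite part_eq0.
- exact: leq_subr.
apply/eqP; rewrite -(eqn_add2r (k * j)) subnK; last by nia.
have -> : k * j = \sum_(i < n) j * (i < k).
  by rewrite -big_distrr /= sum_ltn // mulnC.
rewrite -big_split /= -[X in _ == X](sum_part l (leqnn n)).
apply/eqP/eq_bigr => i _; case: (ltnP i k) => ik; last by lia.
by have := ge _ ik; lia.
Qed.

Lemma cmult_add_rows n k j (l : intpart (n - k * j)) k' :
  0 < k -> 0 < k' -> 0 < j -> k * j <= n ->
  cmult (add_rows l) k' = cmult l k' + j * (k' == k).
Proof.
move=> k0 k'0 j0 kj; rewrite /cmult !part_add_rows //.
have := part_antitone l k'.-1; rewrite prednK // => h.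
by case: (ltngtP k' k) => ?; lia.
Qed.

Lemma add_rowsK n k j (l : intpart (n - k * j)) :
  0 < k -> 0 < j -> k * j <= n -> del_rows k j (add_rows l) = l.
Proof.
move=> k0 j0 kj; apply: part_inj => i.
rewrite part_del_rows ?cmult_add_rows ?eqxx ?muln1 ?leq_addl //.
by rewrite part_add_rows // addnK.
Qed.

Lemma del_rowsK n k j (l : intpart n) :
  0 < k -> 0 < j -> j <= cmult l k -> add_rows (del_rows k j l) = l.
Proof.
move=> k0 j0 jk; have kc := cmult_le l k0; apply: part_inj => i.
rewrite part_add_rows //; last by nia.
rewrite part_del_rows //; case: (ltnP i k) => ik; last by lia.
rewrite muln1 subnK //; apply: leq_trans jk _; rewrite /cmult.
by apply: leq_trans (leq_subr _ _) _; apply: part_homo; lia.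
Qed.

Definition oddcount (n : nat) (l : intpart n) : nat :=
  \sum_(i < n) cmult l i.*2.+1.

Lemma oddcount_widen n (l : intpart n) M : n <= M ->
  \sum_(i < M) cmult l i.*2.+1 = oddcount l.
Proof.
move=> nM; rewrite -(subnKC nM) big_split_ord /= [X in _ + X]big1 ?addn0 //.
by move=> i _; rewrite /cmult part_eq0 ?sub0n //; lia.
Qed.

Lemma oddcount_add_rows n i j (l : intpart (n - i.*2.+1 * j)) :
  0 < j -> i.*2.+1 * j <= n -> oddcount (add_rows l) = oddcount l + j.
Proof.
move=> j0 kj; rewrite {1}/oddcount.
under eq_bigr do rewrite cmult_add_rows //.
rewrite big_split /= oddcount_widen ?leq_subr //.
congr (_ + _); have iN : i < n by nia.
rewrite (bigD1 (Ordinal iN)) //= eqxx muln1 big1 ?addn0 // => i' ne.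
by have /negbTE-> : i'.*2.+1 != i.*2.+1; [move: ne; rewrite -val_eqE /=; lia|rewrite muln0].
Qed.

End Partitions.

(** The terms pair up: [part l i.*2 - part l i.*2.+1] is the multiplicity of [i.*2.+1] in the
    conjugate. *)
Lemma altsumE n (l : intpart n) : altsum l = (oddcount l)%:Z.
Proof.
have e M : \sum_(j < M.*2) (-1) ^+ j * (part l j)%:Z
    = (\sum_(i < M) cmult l i.*2.+1)%N%:Z :> int.
  elim: M => [|M IH]; first by rewrite !big_ord0.
  rewrite doubleS !big_ord_recr /= IH /cmult /= PoszD -addrA; congr (_ + _).
  rewrite exprS -signr_odd odd_double expr0 !mul1r mulr1 mulN1r.
  by have := part_antitone l M.*2; lia.
rewrite /oddcount -e /altsum.
have le : (size l <= n.*2)%N.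
  have /and3P[_ pos /eqP sum] := partsP l.
  by have := size_intpart pos; rewrite sum; lia.
rewrite -(subnKC le) big_split_ord /= [X in _ = _ + X]big1 ?addr0 // => i _.
by rewrite /part nth_default ?mulr0 // leq_addr.
Qed.

(* Double counting: [cmult l k] is the number of [j > 0] such that [j] copies
   of [k] can be removed from the conjugate of [l]. *)
Lemma sum_cmult_mul (R : pzRingType) n k (F : intpart n -> R) : (0 < k)%N ->
  \sum_(l : intpart n) (cmult l k)%:R * F l =
  \sum_(1 <= j < n.+1 | (k * j <= n)%N)
     \sum_(l : intpart (n - k * j)) F (add_rows l).
Proof.
move=> k0.
have E (l : intpart n) : (cmult l k)%:R * F l =
    \sum_(1 <= j < n.+1) if (j <= cmult l k)%N then F l else 0.
  have cn : (cmult l k <= n)%N by have := cmult_le l k0; nia.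
  rewrite -big_mkcond (eq_bigl (fun j => predT j && (j < (cmult l k).+1)%N)) //.
  rewrite -(big_nat_widen _ _ _ predT) //.
  by rewrite sumr_const_nat subn1 mulr_natl.
rewrite (eq_bigr _ (fun l _ => E l)) exchange_big /= [RHS]big_mkcond /=.
apply: eq_big_nat => j /andP[j0 jn]; case: ifP => kj; last first.
  apply: big1 => l _; case: ifP => // jl.
  by have := cmult_le l k0; nia.
rewrite -big_mkcond /= (reindex_onto (@add_rows n k j) (@del_rows n k j)) /=.
  apply: eq_bigl => l; rewrite add_rowsK // eqxx andbT.
  by rewrite cmult_add_rows // eqxx muln1 leq_addl.
by move=> l jl; rewrite del_rowsK.
Qed.

Lemma npart_gt0 n : (0 < npart n)%N.
Proof. by apply/card_gt0P; exists (IntPart (ones_intpart n)). Qed.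

(** Inserting a part 1 into the conjugate is injective. *)
Lemma leq_npartS n : (npart n <= npart n.+1)%N.
Proof.
rewrite [X in npart X](_ : n = n.+1 - 1 * 1)%N; last by lia.
apply: (@leq_card _ _ (@add_rows n.+1 1 1)).
by apply: (can_inj (g := @del_rows n.+1 1 1)) => l; rewrite add_rowsK.
Qed.

(** * Moments of the number of odd parts in terms of partition numbers *)

Section Counts.
Variable R : realType.
Implicit Types (n m k j : nat).

Definition pn (n : nat) : R := (npart n)%:R.

Definition oddsum (m n : nat) : R :=
  \sum_(l : intpart n) (oddcount l)%:R ^+ m.

(** The guard is essential: for [s > n] the truncated [n - s] would give [f 0] instead of 0. *)
Definition lag (f : nat -> R) (n s : nat) : R :=
  if (s <= n)%N then f (n - s)%N else 0.

Lemma pn_gt0 n : 0 < pn n.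
Proof. by rewrite ltr0n npart_gt0. Qed.

Lemma pn_ndec : {homo pn : a b / (a <= b)%N >-> a <= b}.
Proof.
by apply: homo_leq => [//|y x z|n]; [exact: le_trans|rewrite ler_nat leq_npartS].
Qed.

Lemma altsum_momentE m n : altsum_moment R m n = oddsum m n / pn n.
Proof.
rewrite /altsum_moment /altsum_power_sum rmorph_sum; congr (_ / _).
by apply: eq_bigr => l _; rewrite altsumE rmorphXn.
Qed.

Lemma sum_cmult1 n k : (0 < k)%N ->
  \sum_(l : intpart n) (cmult l k)%:R = \sum_(1 <= j < n.+1) lag pn n (k * j).
Proof.
move=> k0; rewrite (eq_bigr (fun l => (cmult l k)%:R * 1)) => [|l _]; last by rewrite mulr1.
rewrite sum_cmult_mul // big_mkcond; apply: eq_bigr => j _.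
by rewrite /lag; case: ifP => // _; rewrite sumr_const.
Qed.

(** This is [sum_cmult] summed over all partitions of [n]. *)
Lemma mul_pn n : n%:R * pn n =
  \sum_(1 <= k < n.+1) k%:R * \sum_(1 <= j < n.+1) lag pn n (k * j).
Proof.
transitivity (\sum_(l : intpart n) \sum_(1 <= k < n.+1) k%:R * (cmult l k)%:R : R).
  rewrite (eq_bigr (fun=> n%:R)) => [|l _]; last first.
    by rewrite -[X in X%:R](sum_cmult l) natr_sum; apply: eq_bigr => k _; rewrite natrM.
  by rewrite sumr_const mulr_natr.
rewrite exchange_big; apply: eq_big_nat => k /andP[k0 _].
by rewrite -sum_cmult1 // mulr_sumr.
Qed.

Lemma oddsum1 n : oddsum 1 n =
  \sum_(i < n) \sum_(1 <= j < n.+1) lag pn n (i.*2.+1 * j).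
Proof.
rewrite /oddsum (eq_bigr (fun l => \sum_(i < n) (cmult l i.*2.+1)%:R)) => [|l _].
  by rewrite exchange_big; apply: eq_bigr => i _; rewrite sum_cmult1.
by rewrite expr1 natr_sum.
Qed.

(** One factor [oddcount l] is expanded into multiplicities; removing [j] copies of an odd part
    lowers the remaining factors by [j]. *)
Lemma oddsumS m n : oddsum m.+1 n =
  \sum_(i < n) \sum_(1 <= j < n.+1 | (i.*2.+1 * j <= n)%N)
    \sum_(l : intpart (n - i.*2.+1 * j)) (oddcount l + j)%:R ^+ m.
Proof.
rewrite /oddsum.
rewrite (eq_bigr (fun l => \sum_(i < n) (cmult l i.*2.+1)%:R * (oddcount l)%:R ^+ m)).
  rewrite exchange_big; apply: eq_bigr => i _; rewrite sum_cmult_mul //.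
  rewrite big_nat_cond [RHS]big_nat_cond.
  apply: eq_bigr => j /andP[/andP[j0 _] kj]; apply: eq_bigr => l _.
  by rewrite oddcount_add_rows.
by move=> l _; rewrite exprS {1}/oddcount natr_sum mulr_suml.
Qed.

Lemma oddcount_le n (l : intpart n) : (oddcount l <= n)%N.
Proof.
rewrite /oddcount -[leqRHS](sum_part l (leqnn _)).
apply: leq_sum => i _; rewrite /cmult /=; apply: leq_trans (leq_subr _ _) _.
by apply: part_homo; lia.
Qed.

Lemma oddsum_ge0 m n : 0 <= oddsum m n.
Proof. by apply: sumr_ge0 => l _; rewrite exprn_ge0. Qed.

Lemma oddsum_le m n : oddsum m n <= n%:R ^+ m * pn n.
Proof.
rewrite mulr_natr -sumr_const; apply: ler_sum => l _.
by rewrite lerXn2r ?nnegrE ?ler_nat ?oddcount_le.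
Qed.

Lemma oddsum_step m n (d : R) : 0 < d ->
  oddsum m.+1 n <=
  (1 + d) ^+ m * \sum_(i < n) \sum_(1 <= j < n.+1) lag (oddsum m) n (i.*2.+1 * j)
  + (1 + d^-1) ^+ m *
    \sum_(i < n) \sum_(1 <= j < n.+1) j%:R ^+ m * lag pn n (i.*2.+1 * j).
Proof.
move=> d0; rewrite oddsumS !mulr_sumr -big_split; apply: ler_sum => i _ /=.
rewrite !mulr_sumr -big_split big_mkcond; apply: ler_sum => j _ /=.
rewrite /lag; case: ifP => _; last by rewrite !mulr0 addr0.
rewrite /pn /npart -[X in _ + _ * (_ * X)]sumr_const !mulr_sumr -big_split.
apply: ler_sum => l _ /=; rewrite mulr1 -!exprMn natrD.
set x : R := (oddcount l)%:R; set y : R := j%:R.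
have x0 : 0 <= x by [].
have y0 : 0 <= y by [].
have d1 : 0 <= 1 + d by rewrite addr_ge0 // ltW.
have d2 : 0 <= 1 + d^-1 by rewrite addr_ge0 // invr_ge0 ltW.
(* If [y <= d * x], then [x + y <= (1 + d) * x]; otherwise [x < y / d] and
   [x + y <= (1 + d^-1) * y]. *)
have [yx|xy] := leP y (d * x).
  apply: le_trans (_ : ((1 + d) * x) ^+ m <= _).
    by rewrite lerXn2r ?nnegrE ?addr_ge0 ?mulr_ge0 // mulrDl mul1r lerD2l.
  by rewrite lerDl exprn_ge0 // mulr_ge0.
apply: le_trans (_ : ((1 + d^-1) * y) ^+ m <= _).
  rewrite lerXn2r ?nnegrE ?addr_ge0 ?mulr_ge0 // mulrDl mul1r addrC lerD2l.
  by rewrite ler_pdivlMl // ltW.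
by rewrite lerDr exprn_ge0 // mulr_ge0.
Qed.

(** A convex function lies above its tangents. In the induction, multiplying by [x] leaves a
    nonnegative multiple of [(x - y) ^+ 2] as defect. *)
Lemma tangent_exprn m (x y : R) : 0 <= x -> 0 <= y ->
  y ^+ m + m%:R * y ^+ m.-1 * (x - y) <= x ^+ m.
Proof.
move=> x0 y0; elim: m => [|m IH]; first by rewrite !mul0r addr0.
apply: le_trans (_ : x * (y ^+ m + m%:R * y ^+ m.-1 * (x - y)) <= _).
  case: m {IH} => [|m] /=; first by rewrite !expr0 expr1; lra.
  have ab := mulr_ge0 (ler0n R m.+1) (exprn_ge0 m y0).
  have -> : m.+2%:R = m.+1%:R + 1 :> R by rewrite natr1.
  rewrite !exprS -subr_ge0; move: (y ^+ m) (m.+1%:R : R) ab => a b ab.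
  suff -> : x * (y * a + b * a * (x - y)) - (y * (y * a) + (b + 1) * (y * a) * (x - y))
     = b * a * (x - y) ^+ 2 by rewrite mulr_ge0 ?sqr_ge0.
  by ring.
by rewrite exprS ler_wpM2l.
Qed.

(** The tangent is taken at the mean [y], so its linear terms cancel in the sum. *)
Lemma oddsum_jensen m n : (oddsum 1 n / pn n) ^+ m <= oddsum m n / pn n.
Proof.
set y := oddsum 1 n / pn n; have p0 := pn_gt0 n.
have y0 : 0 <= y by rewrite divr_ge0 ?oddsum_ge0 // ltW.
have dev0 : \sum_(l : intpart n) ((oddcount l)%:R - y) = 0.
  rewrite big_split /= sumrN sumr_const -mulr_natr -/(npart n) -/(pn n).
  rewrite [X in X - _](_ : _ = oddsum 1 n).
    by rewrite /y divfK ?gt_eqF // subrr.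
  by apply: eq_bigr => l _; rewrite expr1.
have E : y ^+ m * pn n =
    \sum_(l : intpart n) (y ^+ m + m%:R * y ^+ m.-1 * ((oddcount l)%:R - y)).
  by rewrite big_split /= -mulr_sumr dev0 mulr0 addr0 sumr_const mulr_natr.
rewrite ler_pdivlMr // E.
by apply: ler_sum => l _; apply: tangent_exprn.
Qed.

End Counts.

(** * The value of zeta(2) *)

Section Basel.
Variable R : realType.
Implicit Types (x : R) (n N k : nat).

Lemma sin_le_id x : 0 <= x -> sin x <= x.
Proof.
move=> x0.
have [|c _] := @MVT_segment R (fun y => y - sin y) (fun y => 1 - cos y) 0 x x0.
  apply: continuous_subspaceT => y.
  by apply: cvgB; [exact: cvg_id|exact: continuous_sin].
rewrite sin0 !subr0 => e.
by rewrite -subr_ge0 e mulr_ge0 // subr_ge0 cos_le1.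
Qed.

Lemma mulr_cos_le_sin x : 0 <= x <= pi -> x * cos x <= sin x.
Proof.
move=> /andP[x0 xpi].
have [||c /[!in_itv]/= /andP[c0 cx]] :=
    @MVT_segment R (fun y => sin y - y * cos y) (fun y => y * sin y) 0 x x0.
- move=> y _; apply: is_derive_eq.
  by rewrite /GRing.scale /=; ring.
- apply: continuous_subspaceT => y.
  apply: cvgB; first exact: continuous_sin.
  by apply: cvgM; [exact: cvg_id|exact: continuous_cos].
rewrite sin0 mul0r !subr0 => e.
rewrite -subr_ge0 e mulr_ge0 // mulr_ge0 // sin_ge0_pi // c0 /=.
exact: le_trans xpi.
Qed.

(** From [sin x <= x <= tan x]: the lower bound is the squared cotangent. *)
Lemma invr_sqr_bounds x : 0 < x < pi / 2 ->
  (sin x ^+ 2)^-1 - 1 <= (x ^+ 2)^-1 <= (sin x ^+ 2)^-1.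
Proof.
move=> /andP[x0 x1]; have pi0 := pi_gt0 R.
have s0 : 0 < sin x by apply: sin_gt0_pihalf; rewrite x0.
have c0 : 0 < cos x by apply: cos_gt0_pihalf; rewrite x1 andbT; lra.
apply/andP; split; last first.
  by rewrite lef_pV2 ?posrE ?exprn_gt0 // lerXn2r ?nnegrE ?(ltW x0) ?(ltW s0) // sin_le_id // ltW.
have h : x * cos x <= sin x by apply: mulr_cos_le_sin; rewrite ltW //=; lra.
rewrite -(ler_pM2r (exprn_gt0 2 x0)) mulVf ?gt_eqF ?exprn_gt0 //.
have -> : (sin x ^+ 2)^-1 - 1 = cos x ^+ 2 / sin x ^+ 2.
  rewrite cos2sin2; field; exact: lt0r_neq0.
rewrite mulrAC ler_pdivrMr ?exprn_gt0 // mul1r -exprMn mulrC.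
by rewrite lerXn2r // nnegrE ltW // mulr_gt0.
Qed.

(** For [k < 2 ^ n] these are the midpoints of the [2 ^ n] equal pieces of the interval from 0 to
    [pi / 2]. *)
Definition dyadic_angle n k : R := k.*2.+1%:R * pi / 2 ^+ n.+2.

Lemma dyadic_angle_itv n k : (k < 2 ^ n)%N -> 0 < dyadic_angle n k < pi / 2.
Proof.
move=> kn; rewrite /dyadic_angle; have pi0 := pi_gt0 R.
have e0 : 0 < 2 ^+ n.+2 :> R by rewrite exprn_gt0.
apply/andP; split; first by rewrite divr_gt0 // mulr_gt0 ?ltr0n.
rewrite ltr_pdivrMr // exprS mulrA divfK // mulrC.
by rewrite ltr_pM2l // -natrX ltr_nat expnS; lia.
Qed.

(* [1/sin^2 x + 1/sin^2 (pi/2 - x) = 4/sin^2 (2x)], and [x |-> pi/2 - x]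
   reverses the angles of the next level. *)
Lemma sum_invr_sin2 n :
  \sum_(0 <= k < 2 ^ n) (sin (dyadic_angle n k) ^+ 2)^-1 = 2 * 4 ^+ n :> R.
Proof.
elim: n => [|n IH].
  rewrite expn0 big_nat1 expr0 mulr1 /dyadic_angle mul1r.
  have e : cos (pi / 2 ^+ 2) ^+ 2 = sin (pi / 2 ^+ 2) ^+ 2 :> R.
    rewrite {1}(_ : pi / 2 ^+ 2 = pi / 2 - pi / 2 ^+ 2); last by field.
    by rewrite cosB cos_pihalf sin_pihalf mul0r mul1r add0r.
  have := cos2Dsin2 (pi / 2 ^+ 2 : R); rewrite e; set s := sin _ ^+ 2 => h.
  have -> : s = 2^-1 by lra.
  by rewrite invrK.
rewrite expnS mul2n -addnn (big_cat_nat _ (n := 2 ^ n)) //=; last by lia.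
rewrite [X in _ + X](_ : _ = \sum_(0 <= k < 2 ^ n)
    (sin (dyadic_angle n.+1 (2 ^ n + 2 ^ n - k.+1)) ^+ 2)^-1); last first.
  rewrite -{1}[(2 ^ n)%N]add0n big_addn addnK big_nat_rev /=.
  apply: eq_big_nat => k /= kn.
  by rewrite (_ : 0 + 2 ^ n - k.+1 + 2 ^ n = 2 ^ n + 2 ^ n - k.+1)%N //; lia.
rewrite -big_split /= exprS mulrCA -IH mulr_sumr.
apply: eq_big_nat => k /= kn.
have -> : dyadic_angle n.+1 (2 ^ n + 2 ^ n - k.+1) = pi / 2 - dyadic_angle n.+1 k.
  rewrite /dyadic_angle (_ : (2 ^ n + 2 ^ n - k.+1).*2.+1 = 2 ^ n.+2 - k.*2.+1)%N.
    rewrite natrB ?natrX; last by rewrite !expnS; lia.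
    by rewrite !exprS; field; rewrite expf_neq0.
  by rewrite !expnS; lia.
have -> : dyadic_angle n k = dyadic_angle n.+1 k *+ 2.
  by rewrite /dyadic_angle -mulr_natr [in RHS]exprS; field; rewrite expf_neq0.
have kn1 : (k < 2 ^ n.+1)%N by rewrite expnS; lia.
have := dyadic_angle_itv kn1; move: (dyadic_angle n.+1 k) => x /andP[x0 x1].
have -> : sin (pi / 2 - x) = cos x by rewrite sinB cos_pihalf sin_pihalf mul0r mul1r subr0.
have s0 : sin x != 0 by rewrite gt_eqF // sin_gt0_pihalf // x0.
have c0 : cos x != 0 by rewrite gt_eqF // cos_gt0_pihalf // x1 andbT; lra.
have h := cos2Dsin2 x; rewrite sin_mulr2n.
transitivity ((cos x ^+ 2 + sin x ^+ 2) / (sin x * cos x) ^+ 2).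
  by field; rewrite s0 c0.
by rewrite h; field; rewrite s0 c0.
Qed.

(** By [invr_sqr_bounds] the inverse squares of the dyadic angles sum to [2 * 4 ^+ n] up to an error
    of at most [2 ^+ n]; rescaling by [pi ^+ 2 / (16 * 4 ^+ n)] gives both bounds. *)
Lemma sum_odd_bounds n :
  @pi R ^+ 2 / 8 - @pi R ^+ 2 / 16 / 2 ^+ n
   <= \sum_(0 <= k < 2 ^ n) (k.*2.+1%:R ^+ 2)^-1 <= @pi R ^+ 2 / 8.
Proof.
have pi0 := pi_gt0 R; have e0 : 0 < 2 ^+ n :> R by rewrite exprn_gt0.
set S := (X in _ <= X <= _).
have E : \sum_(0 <= k < 2 ^ n) (dyadic_angle n k ^+ 2)^-1 =
    16 * (2 ^+ n) ^+ 2 / pi ^+ 2 * S.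
  rewrite mulr_sumr; apply: eq_bigr => k _; rewrite /dyadic_angle 2!(exprS 2).
  have d0 : k.*2.+1%:R != 0 :> R by rewrite pnatr_eq0.
  by move: (_%:R) d0 (@pi R) pi0 => d d0 p p0; field; rewrite d0 !gt_eqF.
have F : 4 ^+ n = (2 ^+ n) ^+ 2 :> R by rewrite exprAC; congr (_ ^+ _); lra.
have up : \sum_(0 <= k < 2 ^ n) (dyadic_angle n k ^+ 2)^-1 <= 2 * 4 ^+ n.
  rewrite -sum_invr_sin2 !big_mkord; apply: ler_sum => i _.
  by case/andP: (invr_sqr_bounds (dyadic_angle_itv (ltn_ord i))).
have lo : 2 * 4 ^+ n - 2 ^+ n <= \sum_(0 <= k < 2 ^ n) (dyadic_angle n k ^+ 2)^-1.
  have -> : 2 ^+ n = \sum_(0 <= k < 2 ^ n) 1 :> R.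
    by rewrite sumr_const_nat subn0 natrX.
  rewrite -sum_invr_sin2 -sumrB !big_mkord; apply: ler_sum => i _.
  by case/andP: (invr_sqr_bounds (dyadic_angle_itv (ltn_ord i))).
move: up lo; rewrite E F; move: {E} S (2 ^+ n) e0 (@pi R) pi0 => S e e0 p p0 up lo.
have c0 : 0 < p ^+ 2 / (16 * e ^+ 2) by rewrite divr_gt0 ?mulr_gt0 ?exprn_gt0.
apply/andP; split.
  have := ler_wpM2l (ltW c0) lo; congr (_ <= _); field; rewrite ?gt_eqF //.
have := ler_wpM2l (ltW c0) up; congr (_ <= _); field; rewrite ?gt_eqF //.
Qed.

Definition zeta2 N : R := \sum_(0 <= k < N) (k.+1%:R ^+ 2)^-1.

Lemma zeta2_ndec : {homo zeta2 : a b / (a <= b)%N >-> a <= b}.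
Proof.
apply: homo_leq => [//|y x z|N]; first exact: le_trans.
by rewrite /zeta2 big_nat_recr //= lerDl invr_ge0 exprn_ge0.
Qed.

Lemma zeta2_double N :
  zeta2 N.*2 = \sum_(0 <= k < N) (k.*2.+1%:R ^+ 2)^-1 + zeta2 N / 4.
Proof.
rewrite /zeta2; elim: N => [|N IH]; first by rewrite !big_geq // mul0r addr0.
rewrite doubleS !big_nat_recr //= IH -!doubleS -(muln2 N.+1) natrM.
by field; rewrite !gt_eqF // ltr0n.
Qed.

(** With [O] the sum over odd numbers, [zeta2 N <= zeta2 N.*2 = O + zeta2 N / 4], and
    [O <= pi ^+ 2 / 8]. *)
Lemma zeta2_le N : zeta2 N <= @pi R ^+ 2 / 6.
Proof.
have : \sum_(0 <= k < N) (k.*2.+1%:R ^+ 2)^-1 <= @pi R ^+ 2 / 8.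
  case/andP: (sum_odd_bounds N) => _; apply: le_trans.
  have h : (N <= 2 ^ N)%N by rewrite ltnW // ltn_expl.
  rewrite [leRHS](big_cat_nat _ (n := N)) //= lerDl.
  by apply: sumr_ge0 => k _; rewrite invr_ge0 exprn_ge0.
have : zeta2 N <= zeta2 N.*2 by apply: zeta2_ndec; lia.
rewrite zeta2_double; lra.
Qed.

(** An error [C / 2 ^+ n] reproduces itself under doubling when [C / 2 = C / 4 + pi ^+ 2 / 16], that
    is, [C = pi ^+ 2 / 4]. *)
Lemma zeta2_ge n : @pi R ^+ 2 / 6 - @pi R ^+ 2 / 4 / 2 ^+ n <= zeta2 (2 ^ n).
Proof.
elim: n => [|n IH].
  rewrite expn0 expr0 /zeta2 big_nat1 expr1n invr1.
  by have : 0 <= @pi R ^+ 2; [rewrite exprn_ge0 // pi_ge0|lra].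
rewrite expnS mul2n zeta2_double [2 ^+ n.+1]exprS invfM.
case/andP: (sum_odd_bounds n) => + _.
move: IH; move: (2 ^+ n)^-1 (@pi R ^+ 2) => a b; lra.
Qed.

Lemma zeta2_cvg : zeta2 @ \oo --> @pi R ^+ 2 / 6.
Proof.
apply/cvgrPdist_le => e e0.
pose K := Num.truncn (@pi R ^+ 2 / 4 / e : R); exists (2 ^ K)%N => // N /= KN.
rewrite ger0_norm; last by rewrite subr_ge0 zeta2_le.
have := zeta2_ge K; have := zeta2_ndec KN.
suff : @pi R ^+ 2 / 4 / 2 ^+ K <= e by lra.
rewrite ler_pdivrMr ?exprn_gt0 // (mulrC e) -ler_pdivrMr //.
apply: le_trans (ltW (archimedean.Num.Theory.truncnS_gt _)) _.
by rewrite -/K -natrX ler_nat ltn_expl.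
Qed.

End Basel.

(** * Sums of a monotone sequence over multiples *)

Section Blocks.
Variable R : realType.
Implicit Types (g h : nat -> R) (k M n : nat).

Lemma sum_block_up a k :
  \sum_(a.+1 <= s < (a + k).+1) s%:R = a%:R * k%:R + k%:R * (k%:R + 1) / 2 :> R.
Proof.
elim: k => [|k IH]; first by rewrite addn0 big_geq // mulr0 mul0r mul0r addr0.
rewrite addnS big_nat_recr /=; last by lia.
by rewrite IH -addnS natrD -(natr1 k); field.
Qed.

Lemma sum_block_down a k :
  \sum_(a <= s < a + k) s%:R = a%:R * k%:R + k%:R * (k%:R - 1) / 2 :> R.
Proof.
elim: k => [|k IH]; first by rewrite addn0 big_geq // mulr0 mul0r mul0r addr0.
rewrite addnS big_nat_recr /=; last by lia.
by rewrite IH natrD -(natr1 k); field.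
Qed.

(** On a block of [k] indices ending at [k * i] the antitone [h] is least at the end; in [block_ge]
    the block starts at [k * i], where [h] is largest. The weights needed are [g s = 1] and
    [g s = s]. *)
Lemma block_le g h k M : (0 < k)%N -> (forall s, 0 <= g s) ->
  {homo h : a b / (a <= b)%N >-> b <= a} ->
  \sum_(1 <= i < M.+1) h (k * i)%N *
      \sum_((k * i.-1).+1 <= s < (k * i.-1 + k).+1) g s
  <= \sum_(1 <= s < (k * M).+1) g s * h s.
Proof.
move=> k0 g0 hd; elim: M => [|M IH]; first by rewrite muln0 !big_geq.
rewrite big_nat_recr //= mulnS addnC.
rewrite [leRHS](big_cat_nat _ (n := (k * M).+1)) //=; last by lia.
apply: lerD => //; rewrite mulr_sumr big_seq [leRHS]big_seq.
apply: ler_sum => s; rewrite mem_index_iota => ?.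
by rewrite mulrC ler_wpM2l // hd //; lia.
Qed.

Lemma block_ge g h k M : (0 < k)%N -> (forall s, 0 <= g s) ->
  {homo h : a b / (a <= b)%N >-> b <= a} ->
  \sum_(k <= s < k * M.+1) g s * h s <=
  \sum_(1 <= i < M.+1) h (k * i)%N * \sum_(k * i <= s < k * i + k) g s.
Proof.
move=> k0 g0 hd; elim: M => [|M IH]; first by rewrite muln1 !big_geq.
rewrite big_nat_recr //= (big_cat_nat _ (n := (k * M.+1)%N)) //=; [|by nia|by nia].
apply: lerD => //; rewrite mulr_sumr big_seq [leRHS]big_seq.
rewrite (_ : k * M.+1 + k = k * M.+2)%N; last by lia.
apply: ler_sum => s; rewrite mem_index_iota => ?.
by rewrite [leRHS]mulrC ler_wpM2l // hd //; lia.
Qed.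

(** Mere positivity suffices when the non-multiples are simply dropped; this serves the non-monotone
    [s ^+ m.+1 * lag p n s]. *)
Lemma sum_multiples_le h k M : (0 < k)%N -> (forall s, 0 <= h s) ->
  \sum_(1 <= i < M.+1) h (k * i)%N <= \sum_(1 <= s < (k * M).+1) h s.
Proof.
move=> k0 h0; elim: M => [|M IH]; first by rewrite muln0 !big_geq.
rewrite big_nat_recr //= [leRHS](big_cat_nat _ (n := (k * M).+1)) //=; last by lia.
apply: lerD => //; rewrite (_ : k * M.+1 = (k * M + k.-1).+1)%N; last by lia.
rewrite big_nat_recr /=; last by lia.
by rewrite lerDr sumr_ge0.
Qed.

Lemma sum_support h n M : (n <= M)%N -> (forall s, (n < s)%N -> h s = 0) ->
  \sum_(1 <= s < M.+1) h s = \sum_(1 <= s < n.+1) h s.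
Proof.
move=> nM h0; rewrite (big_cat_nat _ (n := n.+1)) //= [X in _ + X]big1_seq ?addr0 //.
by move=> s /andP[_]; rewrite mem_index_iota => /andP[ns _]; apply: h0.
Qed.

Variables (h : nat -> R) (n : nat).
Hypotheses (h_ge0 : forall s, 0 <= h s) (h_supp : forall s, (n < s)%N -> h s = 0).
Hypothesis (h_ninc : {homo h : a b / (a <= b)%N >-> b <= a}).

(** For [h = lag p n], [S1] becomes Q(n) and [S2] becomes T(n). *)
Let S1 := \sum_(1 <= s < n.+1) h s.
Let S2 := \sum_(1 <= s < n.+1) s%:R * h s.

Lemma sum_h_multiples_le k : (0 < k)%N ->
  k%:R * \sum_(1 <= j < n.+1) h (k * j)%N <= S1.
Proof.
move=> k0; have := @block_le (fun=> 1) h k n k0 (fun=> ler01) h_ninc.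
under [leRHS]eq_bigr do rewrite mul1r.
rewrite (@sum_support _ n (k * n)) //; last by nia.
apply: le_trans; rewrite mulr_sumr; apply: ler_sum => i _.
by rewrite sumr_const_nat subSS addKn mulrC.
Qed.

(** The term [k%:R * h 0] pays for the indices below [k], which precede the first block. *)
Lemma sum_h_multiples_ge k : (0 < k)%N ->
  S1 <= k%:R * h 0%N + k%:R * \sum_(1 <= j < n.+1) h (k * j)%N.
Proof.
move=> k0; have := @block_ge (fun=> 1) h k n k0 (fun=> ler01) h_ninc.
under [leLHS]eq_bigr do rewrite mul1r.
rewrite [leRHS](eq_bigr (fun i => k%:R * h (k * i)%N)) => [|i _]; last first.
  by rewrite sumr_const_nat addKn mulrC.
rewrite -mulr_sumr => hle; rewrite /S1 -(@sum_support _ n (k * n.+1).-1) //; last by nia.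
rewrite prednK ?muln_gt0 ?k0 // (big_cat_nat _ (n := k)) //=; last by nia.
apply: lerD => //.
apply: le_trans (_ : \sum_(1 <= i < k) h 0%N <= _).
  by apply: ler_sum => s _; apply: h_ninc.
by rewrite sumr_const_nat mulr_natl ler_wpMn2l ?leq_subr.
Qed.

Let F j := \sum_(1 <= i < n.+1) i%:R * h (j * i)%N.

(** The indices of the block ending at [j * i] sum to at least [j ^ 2 * i / 2]. The factor 2 is the
    price for having no [S1] term, which makes the bound summable over all [j]. *)
Lemma sum_h_weighted_le j : (0 < j)%N -> j%:R ^+ 2 * F j <= 2 * S2.
Proof.
move=> j0; have := @block_le (fun s => s%:R) h j n j0 (fun s => ler0n R s) h_ninc.
rewrite (@sum_support (fun s => s%:R * h s) n (j * n)); last 2 first.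
- by nia.
- by move=> s /h_supp->; rewrite mulr0.
move=> le; suff : 2^-1 * (j%:R ^+ 2 * F j) <= S2 by lra.
apply: le_trans le; rewrite /F !mulr_sumr big_nat [leRHS]big_nat; apply: ler_sum => i /andP[i0 _].
rewrite sum_block_up natrM !mulrA mulrC; apply: ler_wpM2l => //.
have -> : i = i.-1.+1 by lia.
rewrite /= -(natr1 i.-1); have := ler0n R i.-1; have : 1 <= j%:R :> R by rewrite ler1n.
move: (j%:R : R) (i.-1%:R : R) => a b; nra.
Qed.

(** The sum of the indices of a block falls short of [j ^ 2 * i] by less than [j ^ 2], and
    [sum_h_multiples_le] bounds the resulting error by [j * S1]. *)
Lemma sum_h_weighted_upper j : (0 < j)%N -> j%:R ^+ 2 * F j <= S2 + j%:R * S1.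
Proof.
move=> j0; have := @block_le (fun s => s%:R) h j n j0 (fun s => ler0n R s) h_ninc.
rewrite (@sum_support (fun s => s%:R * h s) n (j * n)); last 2 first.
- by nia.
- by move=> s /h_supp->; rewrite mulr0.
move=> le; have := sum_h_multiples_le j0; set D := \sum_(_ <= _ < _) _ => leD.
suff : j%:R ^+ 2 * F j <= S2 + j%:R * (j%:R * D).
  by move=> /le_trans; apply; rewrite lerD2l ler_wpM2l.
apply: le_trans (lerD le (lexx _)).
rewrite /F !mulr_sumr -big_split [leLHS]big_nat [leRHS]big_nat; apply: ler_sum => i /andP[i0 _] /=.
rewrite sum_block_up natrM.
have := h_ge0 (j * i)%N; move: (h (j * i)%N) => x x0.
have -> : i = i.-1.+1 by lia.
rewrite /= -(natr1 i.-1); have j1 : 1 <= j%:R :> R by rewrite ler1n.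
move: (j%:R : R) (i.-1%:R : R) j1 => a b a1.
rewrite -subr_ge0.
suff -> : x * (a * b * a + a * (a + 1) / 2) + a * (a * x) - a ^+ 2 * ((b + 1) * x)
  = x * (a * (a + 1) / 2) by rewrite mulr_ge0 //; nra.
by field.
Qed.

(** One [j * S1] pays for the indices below [j], the other for the excess of the block sums over
    [j ^ 2 * i]. *)
Lemma sum_h_weighted_lower j : (0 < j)%N -> S2 <= j%:R ^+ 2 * F j + 2 * j%:R * S1.
Proof.
move=> j0; have := @block_ge (fun s => s%:R) h j n j0 (fun s => ler0n R s) h_ninc.
move=> le; have := sum_h_multiples_le j0; set D := \sum_(_ <= _ < _) _ => leD.
have -> : S2 = \sum_(1 <= s < j) s%:R * h s + \sum_(j <= s < j * n.+1) s%:R * h s.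
  rewrite -big_cat_nat //=; last by nia.
  rewrite /S2 -(@sum_support (fun s => s%:R * h s) n (j * n.+1).-1).
  - by rewrite prednK // muln_gt0 j0.
  - by nia.
  - by move=> s /h_supp->; rewrite mulr0.
have h1 : \sum_(1 <= s < j) s%:R * h s <= j%:R * S1.
  apply: le_trans (_ : j%:R * \sum_(1 <= s < j) h s <= _).
    rewrite mulr_sumr big_nat [leRHS]big_nat; apply: ler_sum => s /andP[_ sj].
    by rewrite ler_wpM2r // ler_nat ltnW.
  rewrite ler_wpM2l // /S1 -(@sum_support _ n (j * n.+1).-1) //; last by nia.
  rewrite prednK ?muln_gt0 ?j0 // [leRHS](big_cat_nat _ (n := j)) //=; last by nia.
  by rewrite lerDl sumr_ge0.
suff : \sum_(j <= s < j * n.+1) s%:R * h s <= j%:R ^+ 2 * F j + j%:R * (j%:R * D).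
  have := ler_wpM2l (ler0n R j) leD; lra.
apply: le_trans le _.
rewrite /F !mulr_sumr -big_split [leLHS]big_nat [leRHS]big_nat; apply: ler_sum => i /andP[i0 _] /=.
rewrite sum_block_down natrM.
have := h_ge0 (j * i)%N; move: (h (j * i)%N) => x x0.
move: (j%:R : R) (ler0n R j) (i%:R : R) => a a0 b.
rewrite -subr_ge0.
suff -> : a ^+ 2 * (b * x) + a * (a * x) - x * (a * b * a + a * (a - 1) / 2)
  = x * (a * (a + 1) / 2) by rewrite mulr_ge0 //; nra.
by field.
Qed.

End Blocks.

(** * Summatory functions of the partition numbers *)

Section Lag.
Variable R : realType.
Implicit Types (f : nat -> R) (n s : nat).

Lemma lag_ge0 f n : (forall i, 0 <= f i) -> forall s, 0 <= lag f n s.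
Proof. by move=> f0 s; rewrite /lag; case: ifP. Qed.

Lemma lag_supp f n s : (n < s)%N -> lag f n s = 0.
Proof. by rewrite /lag ltnNge => /negbTE ->. Qed.

Lemma lag_ninc f n : (forall i, 0 <= f i) ->
  {homo f : a b / (a <= b)%N >-> a <= b} ->
  {homo lag f n : a b / (a <= b)%N >-> b <= a}.
Proof.
move=> f0 fd a b ab; rewrite /lag; case: ifP => bn; last by case: ifP.
by rewrite (leq_trans ab bn) fd // leq_sub2l.
Qed.

Lemma sum_lag (w : nat -> R) f n :
  \sum_(1 <= s < n.+1) w s * lag f n s = \sum_(0 <= i < n) w (n - i)%N * f i.
Proof.
rewrite big_add1 big_nat_rev /=; apply: eq_big_nat => i /andP[_ lt].
have -> : (0 + n - i.+1).+1 = (n - i)%N by lia.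
by rewrite /lag leq_subr; congr (_ * f _); lia.
Qed.

End Lag.

Section PartitionSums.
Variable R : realType.
Implicit Types (n k j N J : nat).
Local Notation p := (pn R).

Definition psum n : R := \sum_(0 <= i < n) p i.
Definition psum2 n : R := \sum_(0 <= i < n) psum i.+1.

Lemma psumS n : psum n.+1 = psum n + p n.
Proof. by rewrite /psum big_nat_recr. Qed.

Lemma psum2S n : psum2 n.+1 = psum2 n + psum n.+1.
Proof. by rewrite /psum2 big_nat_recr. Qed.

Lemma psum_ge0 n : 0 <= psum n.
Proof. by rewrite sumr_ge0 // => i _; rewrite ltW // pn_gt0. Qed.

Lemma psumS_gt0 n : 0 < psum n.+1.
Proof. by rewrite psumS ltr_wpDl ?psum_ge0 ?pn_gt0. Qed.

Lemma psum2S_gt0 n : 0 < psum2 n.+1.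
Proof.
by rewrite psum2S ltr_wpDl ?psumS_gt0 // sumr_ge0 // => i _; rewrite ltW ?psumS_gt0.
Qed.

Lemma pn_ge0 n : 0 <= p n.
Proof. exact: ltW (pn_gt0 R n). Qed.

Let lag0 n : forall s, 0 <= lag p n s.
Proof. exact: lag_ge0 pn_ge0. Qed.
Let lagd n : {homo lag p n : a b / (a <= b)%N >-> b <= a}.
Proof. exact: lag_ninc pn_ge0 (@pn_ndec R). Qed.
Let lags n := @lag_supp R p n.

Lemma sum_lag_pn n : \sum_(1 <= s < n.+1) lag p n s = psum n.
Proof.
under eq_bigr do rewrite -[lag _ _ _]mul1r.
by rewrite (sum_lag (fun=> 1)); apply: eq_bigr => i _; rewrite mul1r.
Qed.

Lemma sum_weighted_lag_pn n : \sum_(1 <= s < n.+1) s%:R * lag p n s = psum2 n.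
Proof.
rewrite (sum_lag (fun s => s%:R)); elim: n => [|n IH].
  by rewrite /psum2 !big_geq.
rewrite psum2S -IH /psum !big_nat_recr //= addrA -big_split /= subSnn mul1r.
congr (_ + _); apply: eq_big_nat => i /andP[_ lt].
by rewrite subSn ?(ltnW lt) // -natr1 mulrDl mul1r.
Qed.

(** With [j] outside, the inner sum is close to [psum2 n / j ^ 2], whence zeta(2). *)
Lemma mul_pn_swap n : n%:R * p n =
  \sum_(1 <= j < n.+1) \sum_(1 <= k < n.+1) k%:R * lag p n (j * k).
Proof.
rewrite mul_pn exchange_big; apply: eq_bigr => k _; rewrite mulr_sumr.
by apply: eq_bigr => j _; rewrite mulnC.
Qed.

Definition zsum J : R := \sum_(1 <= j < J.+1) (j%:R ^+ 2)^-1.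

Lemma zsumE J : zsum J = zeta2 R J.
Proof. by rewrite /zsum big_add1. Qed.

Lemma zsum_le_pi J : zsum J <= @pi R ^+ 2 / 6.
Proof. by rewrite zsumE zeta2_le. Qed.

Lemma sum_by_sq (a : nat -> R) (b : R) lo hi : (0 < lo)%N ->
  (forall j, (0 < j)%N -> j%:R ^+ 2 * a j <= b) ->
  \sum_(lo <= j < hi) a j <= b * \sum_(lo <= j < hi) (j%:R ^+ 2)^-1.
Proof.
move=> lo0 h; rewrite mulr_sumr [leLHS]big_nat [leRHS]big_nat.
apply: ler_sum => j /andP[j0 _]; rewrite ler_pdivlMr; first by rewrite mulrC h //; lia.
by rewrite exprn_gt0 // ltr0n; lia.
Qed.

(** A bootstrap without [psum]: through [rec_lower] it makes T / Q tend to infinity, so that the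
    [psum] terms of the sharper bounds below become negligible. *)
Lemma mul_pn_le n : n%:R * p n <= 4 * psum2 n * (@pi R ^+ 2 / 6).
Proof.
have h j : (0 < j)%N ->
    j%:R ^+ 2 * \sum_(1 <= k < n.+1) k%:R * lag p n (j * k) <= 2 * psum2 n.
  by rewrite -sum_weighted_lag_pn; apply: (sum_h_weighted_le (@lag0 n) (@lags n) (@lagd n)).
rewrite mul_pn_swap; apply: le_trans (sum_by_sq _ _ h) _ => //.
have := zsum_le_pi n; rewrite /zsum => hz.
have h2 : 0 <= psum2 n by rewrite sumr_ge0 // => i _; rewrite ltW ?psumS_gt0.
rewrite -mulrA -mulrA; set P := psum2 n * _.
have : P <= psum2 n * (@pi R ^+ 2 / 6) by rewrite ler_wpM2l.
have : 0 <= psum2 n * (@pi R ^+ 2 / 6) by rewrite mulr_ge0 // divr_ge0 // exprn_ge0 // pi_ge0.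
lra.
Qed.

(** The sharp estimate is used for [j <= J], the one with factor 2 for the tail. *)
Lemma mul_pn_upper n J : (J <= n)%N -> n%:R * p n <=
  psum2 n * zsum J + J%:R * psum n * zsum J
  + 2 * psum2 n * (@pi R ^+ 2 / 6 - zsum J).
Proof.
move=> Jn; rewrite mul_pn_swap (big_cat_nat _ (n := J.+1)) //=.
have h2 : 0 <= psum2 n by rewrite sumr_ge0 // => i _; rewrite ltW ?psumS_gt0.
apply: lerD.
  rewrite -mulrDl /zsum mulr_sumr [leLHS]big_nat [leRHS]big_nat.
  apply: ler_sum => j /andP[j0 jJ].
  rewrite ler_pdivlMr; last by rewrite exprn_gt0 // ltr0n.
  rewrite mulrC; apply: le_trans (_ : psum2 n + j%:R * psum n <= _).
    by rewrite -sum_weighted_lag_pn -sum_lag_pn;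
      apply: (sum_h_weighted_upper (@lag0 n) (@lags n) (@lagd n)).
  by rewrite lerD2l ler_wpM2r ?psum_ge0 // ler_nat -ltnS.
have h j : (0 < j)%N ->
    j%:R ^+ 2 * \sum_(1 <= k < n.+1) k%:R * lag p n (j * k) <= 2 * psum2 n.
  by rewrite -sum_weighted_lag_pn; apply: (sum_h_weighted_le (@lag0 n) (@lags n) (@lagd n)).
apply: le_trans (sum_by_sq _ _ h) _ => //.
rewrite ler_wpM2l ?mulr_ge0 // -(lerD2l (zsum J)) subrKC.
by apply: le_trans (zsum_le_pi n); rewrite /zsum [leRHS](big_cat_nat _ (n := J.+1)).
Qed.

Lemma mul_pn_lower n J : (J <= n)%N ->
  (psum2 n - 2 * J%:R * psum n) * zsum J <= n%:R * p n.
Proof.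
move=> Jn; rewrite mul_pn_swap (big_cat_nat _ (n := J.+1)) //=.
rewrite -[leLHS]addr0; apply: lerD; last first.
  by apply: sumr_ge0 => j _; apply: sumr_ge0 => k _; rewrite mulr_ge0.
rewrite /zsum mulr_sumr [leLHS]big_nat [leRHS]big_nat; apply: ler_sum => j /andP[j0 jJ].
rewrite ler_pdivrMr; last by rewrite exprn_gt0 // ltr0n.
rewrite lerBlDr.
apply: le_trans (_ : j%:R ^+ 2 * (\sum_(1 <= i < n.+1) i%:R * lag p n (j * i)) +
   2 * j%:R * psum n <= _).
  by rewrite -sum_weighted_lag_pn -sum_lag_pn;
      apply: (sum_h_weighted_lower (@lag0 n) (@lags n) (@lagd n)).
by rewrite [X in X + _ <= _]mulrC lerD2l ler_wpM2r ?psum_ge0 // ler_wpM2l // ler_nat -ltnS.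
Qed.

Lemma sum_lag_multiples_le n k : (0 < k)%N ->
  k%:R * \sum_(1 <= j < n.+1) lag p n (k * j) <= psum n.
Proof. by rewrite -sum_lag_pn; apply: (sum_h_multiples_le (@lags n) (@lagd n)). Qed.

Lemma sum_lag_multiples_ge n k : (0 < k)%N ->
  psum n <= k%:R * p n + k%:R * \sum_(1 <= j < n.+1) lag p n (k * j).
Proof.
rewrite -sum_lag_pn -[X in k%:R * p X](subn0 n) => k0.
exact: (sum_h_multiples_ge (@lag0 n) (@lags n) (@lagd n)).
Qed.

Definition hodd N : R := \sum_(i < N) (i.*2.+1%:R)^-1.

Lemma oddsum1_ge n N : (N <= n)%N ->
  psum n * hodd N - N%:R * p n <= oddsum R 1 n.
Proof.
move=> Nn; rewrite oddsum1 -(subnKC Nn) big_split_ord /= subnKC //.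
rewrite -[leLHS]addr0; apply: lerD; last first.
  by apply: sumr_ge0 => i _; apply: sumr_ge0.
have -> : N%:R * p n = \sum_(i < N) p n by rewrite sumr_const card_ord mulr_natl.
rewrite /hodd mulr_sumr -sumrB.
apply: ler_sum => i _; have k0 : 0 < i.*2.+1%:R :> R by rewrite ltr0n.
rewrite lerBlDr ler_pdivrMr // mulrC mulrDr addrC.
exact: sum_lag_multiples_ge.
Qed.

(** Parts of size at least [N.*2.+1] add up to at most [n], so there are at most [n / N.*2.+1] of
    them. *)
Lemma oddsum1_le n N : (N <= n)%N ->
  oddsum R 1 n <= psum n * hodd N + n%:R * p n / N.*2.+1%:R.
Proof.
move=> Nn; rewrite oddsum1 -(subnKC Nn) big_split_ord /= subnKC //.
apply: lerD.
  rewrite /hodd mulr_sumr; apply: ler_sum => i _.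
  by rewrite ler_pdivlMr ?ltr0n // mulrC sum_lag_multiples_le.
rewrite ler_pdivlMr ?ltr0n // mulr_suml mul_pn.
pose G k := k%:R * \sum_(1 <= j < n.+1) lag p n (k * j).
have G0 k : 0 <= G k by rewrite mulr_ge0 // sumr_ge0.
(* Padding with zero terms up to [n.*2] lets the range split into pairs of an odd and an even
   index. *)
have -> : \sum_(1 <= k < n.+1) G k = \sum_(1 <= k < n.*2.+1) G k.
  rewrite [RHS](big_cat_nat _ (n := n.+1)) //=; last by lia.
  rewrite [X in _ = _ + X]big1_seq ?addr0 // => k /andP[_]; rewrite mem_index_iota => ?.
  rewrite /G big1_seq ?mulr0 // => j /andP[_]; rewrite mem_index_iota => ?.
  by apply: lag_supp; nia.
have -> : \sum_(1 <= k < n.*2.+1) G k = \sum_(i < n) (G i.*2.+1 + G i.*2.+2).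
  elim: (n) => [|m IH]; first by rewrite big_geq // big_ord0.
  by rewrite doubleS big_nat_recr // big_nat_recr //= IH big_ord_recr /= addrA.
rewrite -(subnKC Nn) big_split_ord /= -[leLHS]add0r subnKC //.
apply: lerD; first by apply: sumr_ge0 => i _; rewrite addr_ge0.
apply: ler_sum => i _; rewrite mulrC -[leLHS]addr0; apply: lerD => //.
by rewrite /G ler_wpM2r ?sumr_ge0 // ler_nat; lia.
Qed.

End PartitionSums.

(** * The Riccati recursion *)

Section Recursion.
Variable R : realType.
Implicit Types (w a x : nat -> R) (A B eta : R) (n N : nat).

(* Below 0 the sequence climbs by [eta] at each step, and it cannot fall back. *)
Lemma eventually_ge0 x eta : 0 < eta ->
  (\forall n \near \oo, Num.min (x n) 0 + eta <= x n.+1) ->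
  \forall n \near \oo, 0 <= x n.
Proof.
move=> eta0 [N _ h].
have low t : Num.min (x N + t%:R * eta) 0 <= x (N + t)%N.
  elim: t => [|t IH]; first by rewrite mul0r addr0 addn0 ge_min lexx.
  rewrite addnS; apply: le_trans (h _ (leq_addr _ _)).
  move: IH; rewrite -natr1 mulrDl mul1r !minEle.
  by do ![case: ifP => ?]; lra.
pose T := (Num.truncn (- x N / eta)).+1.
exists (N + T)%N => // n /= Tn.
have -> : n = (N + (n - N))%N by lia.
apply: le_trans (low _); rewrite le_min lexx andbT.
have : - x N / eta <= (n - N)%:R.
  apply: le_trans (ltW (archimedean.Num.Theory.truncnS_gt _)) _.
  by rewrite ler_nat -/T; lia.
by rewrite ler_pdivrMr //; lra.
Qed.

Local Notation rt n := (Num.sqrt n%:R : R).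

Lemma sqrt_natM n : rt n * rt n = n%:R.
Proof. by rewrite -expr2 sqr_sqrtr. Qed.

Lemma sqrt_nat_dvg (K : R) : \forall n \near \oo, K <= rt n.
Proof.
exists (Num.truncn (K ^+ 2)).+1 => // n /= Kn.
have [K0|K0] := leP K 0; first exact: le_trans (sqrtr_ge0 _).
rewrite -[leLHS]ger0_norm ?(ltW K0) // -sqrtr_sqr ler_sqrt //.
apply: le_trans (ltW (archimedean.Num.Theory.truncnS_gt _)) _.
by rewrite ler_nat.
Qed.

Lemma sqrtS_le n : (0 < n)%N -> rt n.+1 <= rt n + (rt n)^-1.
Proof.
move=> n0; have r0 : 0 < rt n by rewrite sqrtr_gt0 ltr0n.
rewrite -[leRHS]ger0_norm; last by rewrite addr_ge0 ?invr_ge0 // ltW.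
rewrite -sqrtr_sqr ler_sqrt ?sqr_ge0 //.
rewrite sqrrD sqr_sqrtr // mulfV ?gt_eqF // -natr1.
have : 0 <= (rt n)^-1 ^+ 2 by rewrite sqr_ge0.
by move: ((rt n)^-1 ^+ 2) (n%:R : R) => u v; lra.
Qed.

(* [v |-> v / (1 + a v)] is increasing, so [w] may be replaced by its minimum
   (or maximum, in [rec_upper]) with [B * sqrt n]; there the step of [w] is
   about [1 - A * B ^ 2], whereas [B * sqrt n] varies by [o(1)]. *)
Lemma rec_lower w a A B : 0 < B -> A * B ^+ 2 < 1 ->
  (forall n, (0 < n)%N -> 0 < w n) -> (forall n, (0 < n)%N -> 0 < a n) ->
  (forall n, (0 < n)%N -> w n.+1 = 1 + w n / (1 + a n * w n)) ->
  (\forall n \near \oo, n%:R * a n <= A) ->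
  \forall n \near \oo, B * rt n <= w n.
Proof.
move=> B0 AB w0 a0 wS aA; pose eta := (1 - A * B ^+ 2) / 2.
have eta0 : 0 < eta by rewrite /eta; lra.
suff : \forall n \near \oo, 0 <= w n - B * rt n.
  by apply: filterS => n; rewrite subr_ge0.
apply: (eventually_ge0 eta0); near=> n.
have n0 : (0 < n)%N by near: n; exists 1%N.
have r0 : 0 < rt n by rewrite sqrtr_gt0 ltr0n.
have hb : B * (rt n)^-1 <= eta.
  rewrite ler_pdivrMr // mulrC -ler_pdivrMr //.
  by near: n; exact: sqrt_nat_dvg.
have hA : n%:R * a n <= A by near: n.
pose v := Num.min (w n) (B * rt n).
have b0 : 0 < B * rt n by rewrite mulr_gt0.
have v0 : 0 < v by rewrite lt_min w0.
have vw : v <= w n by rewrite ge_min lexx.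
have vb : v <= B * rt n by rewrite ge_min lexx orbT.
have av2 : a n * v ^+ 2 <= A * B ^+ 2.
  apply: le_trans (_ : a n * (B * rt n) ^+ 2 <= _).
    by rewrite ler_wpM2l ?(ltW (a0 _ _)) // lerXn2r // nnegrE ltW.
  rewrite exprMn sqr_sqrtr // mulrCA mulrC [X in X * _]mulrC ler_wpM2r //.
  by rewrite sqr_ge0.
have h1 : v - a n * v ^+ 2 <= w n / (1 + a n * w n).
  have aw : 0 < 1 + a n * w n by rewrite ltr_wpDl // mulr_gt0 ?w0 ?a0.
  have av : 0 < 1 + a n * v by rewrite ltr_wpDl // mulr_gt0 ?a0.
  apply: le_trans (_ : v / (1 + a n * v) <= _).
    rewrite ler_pdivlMr // -subr_ge0.
    have -> : v - (v - a n * v ^+ 2) * (1 + a n * v) = a n ^+ 2 * v ^+ 3 by ring.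
    by rewrite mulr_ge0 ?sqr_ge0 // exprn_ge0 // ltW.
  by rewrite ler_pdivrMr // mulrAC ler_pdivlMr // !mulrDr; nra.
have h2 := sqrtS_le n0.
rewrite wS // -(addrK (B * rt n) (Num.min _ _)) addr_minl subrK add0r -/v.
have := ler_wpM2l (ltW B0) h2; rewrite mulrDr.
by move: hb h1 av2; rewrite /eta; lra.
Unshelve. all: by end_near. Qed.

Lemma rec_upper w a A B : 0 < A -> 0 < B -> 1 < A * B ^+ 2 ->
  (forall n, (0 < n)%N -> 0 < w n) -> (forall n, (0 < n)%N -> 0 < a n) ->
  (forall n, (0 < n)%N -> w n.+1 = 1 + w n / (1 + a n * w n)) ->
  (\forall n \near \oo, A <= n%:R * a n) ->
  \forall n \near \oo, w n <= B * rt n.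
Proof.
move=> A0 B0 AB w0 a0 wS aA; pose eta := (A * B ^+ 2 - 1) / 2.
have eta0 : 0 < eta by rewrite /eta; lra.
suff : \forall n \near \oo, 0 <= B * rt n - w n.
  by apply: filterS => n; rewrite subr_ge0.
apply: (eventually_ge0 eta0); near=> n.
have n0 : (0 < n)%N by near: n; exists 1%N.
have r0 : 0 < rt n by rewrite sqrtr_gt0 ltr0n.
have hb : (1 + eta) * (A * B) <= eta * rt n.
  rewrite mulrC -ler_pdivrMl // .
  by near: n; exact: sqrt_nat_dvg.
have hA : A <= n%:R * a n by near: n.
have [v vE] : {v | v = Num.max (w n) (B * rt n)} by eexists.
have b0 : 0 < B * rt n by rewrite mulr_gt0.
have v0 : 0 < v by rewrite vE lt_max w0.
have wv : w n <= v by rewrite vE le_max lexx.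
have bv : B * rt n <= v by rewrite vE le_max lexx orbT.
have aw : 0 < 1 + a n * w n by rewrite ltr_wpDl // mulr_gt0 ?w0 ?a0.
have av : 0 < 1 + a n * v by rewrite ltr_wpDl // mulr_gt0 ?a0.
have h1 : w n / (1 + a n * w n) <= v / (1 + a n * v).
  rewrite ler_pdivrMr // mulrAC ler_pdivlMr // -subr_ge0.
  by rewrite (_ : _ - _ = v - w n) ?subr_ge0 //; ring.
have t0 : 0 < a n * v by rewrite mulr_gt0 ?a0.
have ab : A * B <= rt n * (a n * v).
  apply: le_trans (_ : (n%:R * a n) * B <= _); first by rewrite ler_wpM2r // ltW.
  rewrite -[X in X * _ * _]sqrt_natM; have := ler_wpM2l (ltW (mulr_gt0 r0 (a0 _ n0))) bv.
  by move: (a n) (rt n) => *; lra.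
have h3 : 1 + eta <= v - v / (1 + a n * v).
  have -> : v - v / (1 + a n * v) = (a n * v) * v / (1 + a n * v).
    by field; rewrite gt_eqF.
  rewrite ler_pdivlMr //; apply: le_trans (ler_wpM2l (ltW t0) bv).
  have AB0 := mulr_gt0 A0 B0.
  have etaE : A * B * B = 1 + 2 * eta by rewrite /eta; lra.
  move: (rt n) (a n * v) r0 t0 ab hb etaE => r t r0 t0 ab hb etaE.
  (* In terms of [d], the goal [(1 + eta) * (1 + t) <= t * (B * r)] reads [1 + eta <= t * d]. *)
  pose d := B * r - (1 + eta).
  have hd : (1 + eta) * r <= A * B * d.
    have -> : A * B * d = A * B * B * r - (1 + eta) * (A * B) by rewrite /d; ring.
    by rewrite etaE; lra.
  have d0 : 0 < d.
    rewrite -(pmulr_rgt0 _ AB0); apply: lt_le_trans hd.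
    by rewrite mulr_gt0 // addr_gt0.
  have : 1 + eta <= t * d.
    rewrite -(ler_pM2l r0) mulrC; apply: le_trans hd _.
    by rewrite mulrA ler_wpM2r // ltW.
  have -> : t * d = t * (B * r) - t * (1 + eta) by rewrite /d; ring.
  by rewrite mulrDr mulr1; lra.
have h2 : rt n <= rt n.+1 by rewrite ler_sqrt // ler_nat.
have := ler_wpM2l (ltW B0) h2.
have : Num.min (B * rt n - w n) 0 = B * rt n - v.
  by rewrite vE minEle maxEle; do ![case: ifP => ?]; lra.
by rewrite wS // => ->; lra.
Unshelve. all: by end_near. Qed.

End Recursion.

(** * Asymptotics of T / Q and of Q / p *)

Section PartitionAsymptotics.
Variable R : realType.
Implicit Types (n N J : nat) (B : R).
Local Notation p := (pn R).
Local Notation rt n := (Num.sqrt n%:R : R).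
Local Notation c2 := (@pi R ^+ 2 / 6).

(** The unknown [w] of the recursion; [pn_ratio] is its coefficient [a]. *)
Definition sum_ratio n : R := psum2 R n / psum R n.
Definition pn_ratio n : R := p n / psum2 R n.

Lemma psum_gt0 n : (0 < n)%N -> 0 < psum R n.
Proof. by case: n => // n _; exact: psumS_gt0. Qed.

Lemma psum2_gt0 n : (0 < n)%N -> 0 < psum2 R n.
Proof. by case: n => // n _; exact: psum2S_gt0. Qed.

Lemma sum_ratio_gt0 n : (0 < n)%N -> 0 < sum_ratio n.
Proof. by move=> n0; rewrite divr_gt0 ?psum_gt0 ?psum2_gt0. Qed.

Lemma pn_ratio_gt0 n : (0 < n)%N -> 0 < pn_ratio n.
Proof. by move=> n0; rewrite divr_gt0 ?pn_gt0 ?psum2_gt0. Qed.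

(** T(n+1) = T(n) + Q(n+1) and Q(n+1) = Q(n) + p(n), while [pn_ratio n * sum_ratio n] is p(n) /
    Q(n). *)
Lemma sum_ratioS n : (0 < n)%N ->
  sum_ratio n.+1 = 1 + sum_ratio n / (1 + pn_ratio n * sum_ratio n).
Proof.
move=> n0; have s1 := psum_gt0 n0; have s2 := psum2_gt0 n0; have p0 := pn_gt0 R n.
rewrite /sum_ratio /pn_ratio psum2S psumS; field.
by rewrite !gt_eqF // addr_gt0.
Qed.

Lemma zeta2_limit_gt0 : 0 < c2.
Proof. by rewrite divr_gt0 // exprn_gt0 // pi_gt0. Qed.

Lemma sum_ratio_inv_cvg0 : (sum_ratio n)^-1 @[n --> \oo] --> 0.
Proof.
have pi0 := zeta2_limit_gt0.
pose A := 4 * c2 : R.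
have A0 : 0 < A by rewrite mulr_gt0.
pose B : R := (2 * (A + 1))^-1.
have B0 : 0 < B by rewrite invr_gt0 mulr_gt0 // addr_gt0.
have h : \forall n \near \oo, B * rt n <= sum_ratio n.
  apply: (@rec_lower R _ pn_ratio A B) => //.
  - rewrite /B exprVn ltr_pdivrMr ?exprn_gt0 ?mulr_gt0 ?addr_gt0 // mul1r.
    by nra.
  - exact: sum_ratio_gt0.
  - exact: pn_ratio_gt0.
  - exact: sum_ratioS.
  exists 1%N => // n /= n0; rewrite /pn_ratio mulrA ler_pdivrMr ?psum2_gt0 //.
  by rewrite /A; have := mul_pn_le R n; lra.
apply/cvgr0Pnorm_le => e e0; near=> n.
have n0 : (0 < n)%N by near: n; exists 1%N.
have w0 := sum_ratio_gt0 n0.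
rewrite ger0_norm ?invr_ge0 ?(ltW w0) //.
rewrite -[leRHS]invrK lef_pV2 ?posrE ?invr_gt0 //.
have : B * rt n <= sum_ratio n by near: n.
apply: le_trans; rewrite mulrC -ler_pdivrMr //.
by near: n; exact: sqrt_nat_dvg.
Unshelve. all: by end_near. Qed.

(** First [J] is fixed to make the tail of zeta(2) small, then [n] is taken large enough for [J]
    times Q(n) / T(n) to be small. *)
Lemma pn_ratio_cvg : n%:R * pn_ratio n @[n --> \oo] --> c2.
Proof.
have pi0 := zeta2_limit_gt0.
apply/cvgrPdist_le => e e0.
pose d := e / 3; have d0 : 0 < d by rewrite divr_gt0.
have /cvgrPdist_le/(_ d d0) [J _ hJ] := @zeta2_cvg R.
have {}hJ : c2 - d <= zsum R J.
  have := hJ J (leqnn _); rewrite -zsumE ger0_norm ?subr_ge0 ?zsum_le_pi //; lra.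
have hJ' := zsum_le_pi R J.
have zJ0 : 0 <= zsum R J by rewrite /zsum sumr_ge0 // => j _; rewrite invr_ge0 exprn_ge0.
pose K : R := 2 * J%:R * c2 + 1.
have K0 : 0 < K by rewrite ltr_wpDl // mulr_ge0 ?(ltW pi0) // mulr_ge0.
have dK : 0 < d / K by rewrite divr_gt0.
near=> n.
have n0 : (0 < n)%N by near: n; exists 1%N.
have Jn : (J <= n)%N by near: n; exists J.
have s2 := psum2_gt0 n0; have s1 := psum_gt0 n0.
have hr : (sum_ratio n)^-1 <= d / K.
  near: n; have /cvgr0Pnorm_le/(_ _ dK) := sum_ratio_inv_cvg0.
  by apply: filterS => n; apply: le_trans; exact: ler_norm.
set r := (sum_ratio n)^-1 in hr.
have r0 : 0 <= r by rewrite invr_ge0 ltW // sum_ratio_gt0.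
have rE : psum R n = r * psum2 R n by rewrite /r /sum_ratio invf_div divfK ?gt_eqF.
have hKr : K * r <= d by rewrite mulrC -ler_pdivlMr.
have JZ : 0 <= J%:R * zsum R J <= J%:R * c2 by rewrite mulr_ge0 //= ler_wpM2l.
have up : n%:R * pn_ratio n <= zsum R J + J%:R * r * zsum R J + 2 * (c2 - zsum R J).
  rewrite /pn_ratio mulrA ler_pdivrMr //; apply: le_trans (mul_pn_upper R Jn) _.
  by rewrite rE; lra.
have lo : (1 - 2 * J%:R * r) * zsum R J <= n%:R * pn_ratio n.
  rewrite /pn_ratio mulrA ler_pdivlMr //; apply: le_trans _ (mul_pn_lower R Jn).
  by rewrite rE; lra.
have JZr : J%:R * zsum R J * r <= J%:R * c2 * r by case/andP: JZ => _ ?; rewrite ler_wpM2r.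
have JZr0 : 0 <= J%:R * zsum R J * r by case/andP: JZ => ? _; rewrite mulr_ge0.
have eE : e = 3 * d by rewrite /d; field.
move: hKr; rewrite /K eE => hKr; rewrite ler_norml; apply/andP; split; lra.
Unshelve. all: by end_near. Qed.

(** For [B] on either side of [c^-1] the midpoint [A] of [c2] and [(B ^+ 2)^-1] satisfies the
    hypotheses of [rec_lower] or [rec_upper]. *)
Lemma sum_ratio_cvg : sum_ratio n / rt n @[n --> \oo] --> (Num.sqrt c2)^-1.
Proof.
have pi0 := zeta2_limit_gt0; set c := Num.sqrt c2.
have c0 : 0 < c by rewrite sqrtr_gt0.
have cE : c2 = c ^+ 2 by rewrite sqr_sqrtr // ltW.
have lower B : 0 < B -> B < c^-1 -> \forall n \near \oo, B * rt n <= sum_ratio n.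
  move=> B0 Bc; have Bc2 : c2 < (B ^+ 2)^-1.
    by rewrite cE -exprVn ltrXn2r // ?nnegrE ?invr_ge0 ?ltW //
      -[ltLHS]invrK ltf_pV2 ?posrE ?invr_gt0.
  pose A := (c2 + (B ^+ 2)^-1) / 2.
  apply: (@rec_lower R _ pn_ratio A B) => //.
  - by rewrite -ltr_pdivlMr ?exprn_gt0 // mul1r /A; lra.
  - exact: sum_ratio_gt0.
  - exact: pn_ratio_gt0.
  - exact: sum_ratioS.
  by apply: (cvgr_le _ pn_ratio_cvg); rewrite /A; lra.
have upper B : c^-1 < B -> \forall n \near \oo, sum_ratio n <= B * rt n.
  move=> Bc; have B0 : 0 < B by apply: lt_trans Bc; rewrite invr_gt0.
  have Bc2 : (B ^+ 2)^-1 < c2.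
    by rewrite cE -exprVn ltrXn2r // ?nnegrE ?invr_ge0 ?ltW //
      -[ltRHS]invrK ltf_pV2 ?posrE ?invr_gt0.
  have B2 : 0 < (B ^+ 2)^-1 by rewrite invr_gt0 exprn_gt0.
  pose A := (c2 + (B ^+ 2)^-1) / 2.
  apply: (@rec_upper R _ pn_ratio A B) => //.
  - by rewrite /A; lra.
  - by rewrite -ltr_pdivrMr ?exprn_gt0 // mul1r /A; lra.
  - exact: sum_ratio_gt0.
  - exact: pn_ratio_gt0.
  - exact: sum_ratioS.
  by apply: (cvgr_ge _ pn_ratio_cvg); rewrite /A; lra.
apply/cvgrPdist_le => e e0.
(* The maximum keeps [B] positive when [e] is large. *)
pose B := Num.max (c^-1 - e) (c^-1 / 2).
have ci0 : 0 < c^-1 by rewrite invr_gt0.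
have B0 : 0 < B by rewrite lt_max divr_gt0 ?orbT.
have Bc : B < c^-1 by rewrite gt_max; apply/andP; split; lra.
near=> n.
have n0 : (0 < n)%N by near: n; exists 1%N.
have rn0 : 0 < rt n by rewrite sqrtr_gt0 ltr0n.
have lo : B <= sum_ratio n / rt n by rewrite ler_pdivlMr //; near: n; exact: lower.
have up : sum_ratio n / rt n <= c^-1 + e.
  by rewrite ler_pdivrMr //; near: n; apply: upper; lra.
have : c^-1 - e <= B by rewrite le_max lexx.
by rewrite ler_norml; move=> ?; apply/andP; split; lra.
Unshelve. all: by end_near. Qed.

Lemma psum_pn_cvg : psum R n / p n / rt n @[n --> \oo] --> (Num.sqrt c2)^-1.
Proof.
have pi0 := zeta2_limit_gt0; set c := Num.sqrt c2.
have c0 : 0 < c by rewrite sqrtr_gt0.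
have cE : c2 = c ^+ 2 by rewrite sqr_sqrtr // ltW.
(* Since Q / p is the inverse of [sum_ratio n * pn_ratio n], the limit appears as the product of two
   inverse limits. *)
have -> : c^-1 = (c^-1)^-1 / c2 by rewrite cE; field; rewrite gt_eqF.
have ci0 : c^-1 != 0 by rewrite gt_eqF // invr_gt0.
have h : (sum_ratio n / rt n)^-1 * (n%:R * pn_ratio n)^-1 @[n --> \oo] --> c^-1^-1 / c2.
  by apply: cvgM; apply: cvgV => //; [exact: sum_ratio_cvg|exact: lt0r_neq0|exact: pn_ratio_cvg].
apply: cvg_trans h; apply: near_eq_cvg; near=> n.
have n0 : (0 < n)%N by near: n; exists 1%N.
have rn0 : 0 < rt n by rewrite sqrtr_gt0 ltr0n.
have s2 := psum2_gt0 n0; have s1 := psum_gt0 n0; have p0 := pn_gt0 R n.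
rewrite /sum_ratio /pn_ratio -[X in (X * (_ / _))^-1]sqrt_natM; field.
by rewrite !gt_eqF.
Unshelve. all: by end_near. Qed.

End PartitionAsymptotics.

(** * Moments *)

Section Moments.
Variable R : realType.
Implicit Types (m n i j k N : nat).
Local Notation p := (pn R).
Local Notation rt n := (Num.sqrt n%:R : R).
Local Notation lg n := (ln (n%:R : R)).
Local Notation c := (Num.sqrt (@pi R ^+ 2 / 6)).

(** Each term is compared with half an increment of [ln] through [ln (1 + y) <= y], at [y = 2 / x]
    here and at [y = - (2 / x)] in [hodd_le]. *)
Lemma hodd_ge N : ln N.*2.+1%:R / 2 <= hodd R N.
Proof.
elim: N => [|N IH]; first by rewrite /hodd big_ord0 ln1 mul0r.
rewrite /hodd big_ord_recr /= doubleS -addn2 natrD.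
have x0 : 0 < N.*2.+1%:R :> R by rewrite ltr0n.
move: IH; rewrite /hodd; move: (N.*2.+1%:R : R) x0 => x x0.
have -> : x + 2 = x * (1 + 2 / x).
  by rewrite mulrDr mulr1 mulrCA mulfV ?gt_eqF // mulr1.
have d0 : 0 < x^-1 by rewrite invr_gt0.
rewrite lnM ?posrE ?addr_gt0 ?divr_gt0 //.
have : ln (1 + 2 / x) <= 2 / x by apply: le_ln1Dx; lra.
lra.
Qed.

Lemma hodd_le N : hodd R N <= 1 + ln N.*2.+1%:R / 2.
Proof.
suff h M : hodd R M.+1 <= 1 + ln M.*2.+1%:R / 2.
  case: N => [|N]; first by rewrite /hodd big_ord0 ln1 mul0r addr0.
  apply: le_trans (h N) _; rewrite lerD2l ler_wpM2r ?invr_ge0 //.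
  by rewrite ler_ln ?posrE ?ltr0n // ler_nat; lia.
elim: M => [|M IH]; first by rewrite /hodd big_ord1 ln1 mul0r addr0 invr1.
rewrite /hodd big_ord_recr /=.
have E : M.*2.+1%:R = M.+1.*2.+1%:R - 2 :> R.
  by rewrite doubleS -[M.*2.+3]addn2 natrD addrK.
have x2 : 2 < M.+1.*2.+1%:R :> R by rewrite ltr_nat doubleS; lia.
move: IH; rewrite E /hodd; move: (M.+1.*2.+1%:R : R) x2 => x x2.
have x0 : 0 < x by lra.
have -> : x - 2 = x * (1 - 2 / x).
  by rewrite mulrBr mulr1 mulrCA mulfV ?gt_eqF // mulr1.
have d1 : 2 / x < 1 by rewrite ltr_pdivrMr // mul1r.
rewrite lnM ?posrE ?subr_gt0 //.
have : ln (1 - 2 / x) <= - (2 / x) by apply: le_ln1Dx; lra.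
lra.
Qed.

Lemma ln_nat_dvg (K : R) : \forall n \near \oo, K <= lg n.
Proof.
exists (Num.truncn (expR K)).+1 => // n /= Kn.
have h : expR K <= n%:R.
  apply: le_trans (ltW (archimedean.Num.Theory.truncnS_gt _)) _.
  by rewrite ler_nat.
by rewrite -ler_expR lnK // posrE (lt_le_trans (expR_gt0 K)).
Qed.

Lemma ln_sqrt n : (0 < n)%N -> ln (rt n) = lg n / 2.
Proof.
move=> n0; have r0 : 0 < rt n by rewrite sqrtr_gt0 ltr0n.
by rewrite -[in RHS](sqrt_natM R n) lnM ?posrE //; lra.
Qed.

Lemma ln3_le : ln 3 <= 2 :> R.
Proof. by rewrite (_ : 3 = 1 + 2); [apply: le_ln1Dx|]; lra. Qed.

Lemma invr_ln_cvg0 : (lg n)^-1 @[n --> \oo] --> (0 : R).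
Proof.
apply/cvgr0Pnorm_le => e e0; near=> n.
have h : e^-1 <= lg n by near: n; exact: ln_nat_dvg.
have l0 : 0 < lg n by apply: lt_le_trans h; rewrite invr_gt0.
by rewrite ger0_norm ?invr_ge0 ?(ltW l0) // -[leRHS]invrK lef_pV2 ?posrE ?invr_gt0.
Unshelve. all: by end_near. Qed.

Lemma cvg_exprn (u : nat -> R) (a : R) m :
  u n @[n --> \oo] --> a -> u n ^+ m @[n --> \oo] --> a ^+ m.
Proof.
move=> ua; elim: m => [|m IH]; first exact: cvg_cst.
by rewrite exprS; under eq_fun do rewrite exprS; apply: cvgM.
Qed.

Definition scale n : R := rt n * lg n.

Lemma oddsum1_cvg : oddsum R 1 n / p n / scale n @[n --> \oo] --> (4 * c)^-1.
Proof.
pose s n := psum R n / p n / rt n.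
have scvg : s n @[n --> \oo] --> c^-1 := @psum_pn_cvg R.
have lcvg := invr_ln_cvg0.
have -> : (4 * c)^-1 = c^-1 * 4^-1 by rewrite invfM mulrC.
apply: (@squeeze_cvgr _ _ _ _ (fun n => s n * 4^-1 - (lg n)^-1)
   (fun n => s n * 4^-1 + s n * (2 * (lg n)^-1) + (lg n)^-1)); last 2 first.
- rewrite -[X in _ --> X]subr0; apply: cvgB => //.
  by apply: cvgM => //; exact: cvg_cst.
- rewrite -[X in _ --> X]addr0 -[X in _ --> X + _]addr0 -[X in _ --> _ + X + _](mulr0 c^-1).
  apply: cvgD => //; apply: cvgD; apply: cvgM => //; first exact: cvg_cst.
  by rewrite -[X in _ --> X](mulr0 2); apply: cvgM => //; exact: cvg_cst.
near=> n.
have n0 : (0 < n)%N by near: n; exists 1%N.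
have r0 : 0 < rt n by rewrite sqrtr_gt0 ltr0n.
have r1 : 1 <= rt n by near: n; exact: sqrt_nat_dvg.
have l1 : 1 <= lg n by near: n; exact: ln_nat_dvg.
have l0 : 0 < lg n by exact: lt_le_trans l1.
have p0 := pn_gt0 R n.
have nE := sqrt_natM R n; have lE := ln_sqrt n0.
(* At this cutoff [hodd R N] is [lg n / 4] up to a constant, and the errors [N%:R * p n] and
   [n%:R * p n / N.*2.+1%:R] are both at most [rt n * p n], a factor [lg n] below the main term. *)
pose N := Num.truncn (rt n).
have /andP[Nr rN] := archimedean.Num.Theory.truncn_itv (sqrtr_ge0 n%:R : 0 <= rt n).
rewrite -/N in Nr rN.
have Nn : (N <= n)%N.
  by rewrite -(ler_nat R) (le_trans Nr) // -[leRHS]nE ler_peMr // ltW.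
have rN2 : rt n <= N.*2.+1%:R by apply: le_trans (ltW rN) _; rewrite ler_nat; lia.
have N2r : N.*2.+1%:R <= 3 * rt n.
  by rewrite -addnn -natr1 natrD; lra.
have x0 : 0 < N.*2.+1%:R :> R by rewrite ltr0n.
have h1 : lg n / 4 <= hodd R N.
  apply: le_trans (hodd_ge N); have : ln (rt n) <= ln (N.*2.+1%:R) by rewrite ler_ln ?posrE.
  by rewrite lE; lra.
have h2 : hodd R N <= 2 + lg n / 4.
  apply: le_trans (hodd_le N) _.
  have : ln (N.*2.+1%:R) <= ln (3 * rt n) by rewrite ler_ln ?posrE ?mulr_gt0.
  by rewrite lnM ?posrE // lE; have := ln3_le; lra.
have ps : psum R n = s n * rt n * p n by rewrite /s !divfK ?gt_eqF.
have s0 : 0 <= s n by rewrite /s !divr_ge0 ?psum_ge0 // ltW.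
have g0 : 0 < p n * scale n by rewrite !mulr_gt0.
have -> : oddsum R 1 n / p n / scale n = oddsum R 1 n / (p n * scale n).
  by rewrite [in RHS]invfM mulrA.
apply/andP; split.
  rewrite ler_pdivlMr //; apply: le_trans (oddsum1_ge R Nn).
  have -> : (s n * 4^-1 - (lg n)^-1) * (p n * scale n) =
      s n * rt n * p n * (lg n / 4) - rt n * p n.
    by rewrite /scale; field; rewrite gt_eqF.
  apply: lerB; first by rewrite ps ler_wpM2l // mulr_ge0 ?(ltW p0) // mulr_ge0.
  by rewrite ler_wpM2r // ltW.
rewrite ler_pdivrMr //; apply: le_trans (oddsum1_le R Nn) _.
have -> : (s n * 4^-1 + s n * (2 * (lg n)^-1) + (lg n)^-1) * (p n * scale n) =
    s n * rt n * p n * (2 + lg n / 4) + rt n * p n.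
  by rewrite /scale; field; rewrite gt_eqF.
apply: lerD; first by rewrite ps ler_wpM2l // mulr_ge0 ?(ltW p0) // mulr_ge0.
rewrite mulrAC ler_wpM2r ?(ltW p0) // ler_pdivrMr // -[leLHS]nE.
by rewrite ler_wpM2l // ltW.
Unshelve. all: by end_near. Qed.

(** * Bounds for the sums weighted by powers of the number of copies *)

Lemma psum_bound : exists2 Y : R, 0 <= Y & forall n, psum R n <= Y * rt n * p n.
Proof.
have pi0 := zeta2_limit_gt0 R.
have c0 : 0 < c by rewrite sqrtr_gt0.
have c1 : c^-1 < c^-1 + 1 by rewrite ltrDl.
have [N _ hN] := cvgr_le _ (@psum_pn_cvg R) _ c1.
have Y0 : 0 <= c^-1 + 1 by rewrite addr_ge0 // invr_ge0 ltW.
(* The summand [rt N] covers the finitely many [n < N], through [psum R n <= n%:R * p n]. *)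
exists (c^-1 + 1 + rt N) => [|n]; first by rewrite addr_ge0.
have p0 := pn_gt0 R n.
have [Nn|nN] := leqP N n.
  have [->|n0] := posnP n; first by rewrite /psum big_geq // !mulr_ge0 // ltW.
  have r0 : 0 < rt n by rewrite sqrtr_gt0 ltr0n.
  have := hN n Nn; rewrite /= ler_pdivrMr // ler_pdivrMr // => /le_trans; apply.
  by rewrite ler_wpM2r ?(ltW p0) // ler_wpM2r // lerDl.
apply: le_trans (_ : n%:R * p n <= _).
  rewrite mulr_natl -[X in p n *+ X]subn0 -sumr_const_nat /psum big_nat [leRHS]big_nat.
  by apply: ler_sum => i /andP[_ lt]; rewrite pn_ndec // ltnW.
rewrite ler_wpM2r ?(ltW p0) // -[leLHS]sqrt_natM ler_wpM2r //.
apply: le_trans (_ : rt N <= _); first by rewrite ler_sqrt // ler_nat ltnW.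
by rewrite lerDr.
Qed.

Definition psum_moment m n : R := \sum_(0 <= i < n) (n - i)%:R ^+ m * p i.

(** From [n] to [n.+1] the weight [(n - i) ^ m.+1] grows by at most [m.+1 * (n.+1 - i) ^ m], by the
    tangent inequality; these increments are summed. *)
Lemma psum_momentS m n :
  psum_moment m.+1 n <= m.+1%:R * \sum_(0 <= l < n.+1) psum_moment m l.
Proof.
elim: n => [|n IH].
  by rewrite /psum_moment big_geq // mulr_ge0 // big_nat1 big_geq.
rewrite big_nat_recr //= mulrDr; apply: le_trans (lerD IH (lexx _)).
have -> : psum_moment m.+1 n = \sum_(0 <= i < n.+1) (n - i)%:R ^+ m.+1 * p i.
  by rewrite big_nat_recr //= subnn expr0n mul0r addr0.
rewrite /psum_moment mulr_sumr -big_split [leLHS]big_nat [leRHS]big_nat.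
apply: ler_sum => i /andP[_ ile] /=.
rewrite mulrA -mulrDl ler_wpM2r ?pn_ge0 //.
have := @tangent_exprn R m.+1 (n - i)%:R (n.+1 - i)%:R (ler0n _ _) (ler0n _ _).
rewrite subSn // -(natr1 (n - i)) /=.
by move: ((n - i)%:R : R) => x; rewrite opprD addrA subrr sub0r mulrN1; lra.
Qed.

(** Each order costs one more summation of [p], hence one factor [rt n] by [psum_bound]. *)
Lemma psum_moment_bound m : exists2 K : R, 0 <= K &
  forall n, psum_moment m n <= K * rt n ^+ m.+1 * p n.
Proof.
have [Y Y0 hY] := psum_bound.
elim: m => [|m [K K0 hK]].
  exists Y => // n; rewrite expr1; apply: le_trans (hY n).
  by rewrite le_eqVlt; apply/orP; left; apply/eqP; apply: eq_bigr => i _; rewrite mul1r.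
exists (m.+1%:R * K * (Y + 1)) => [|n]; first by rewrite !mulr_ge0 // addr_ge0.
have [->|n0] := posnP n.
  by rewrite /psum_moment big_geq // mulr_ge0 ?pn_ge0 //
    mulr_ge0 ?exprn_ge0 // mulr_ge0 ?mulr_ge0 ?addr_ge0.
have r1 : 1 <= rt n by rewrite -[leLHS]sqrtr1 ler_sqrt // ler1n.
apply: le_trans (psum_momentS m n) _.
have -> : m.+1%:R * K * (Y + 1) * rt n ^+ m.+2 * p n =
    m.+1%:R * (K * ((Y + 1) * (rt n ^+ m.+1 * (rt n * p n)))).
  by rewrite exprSr; ring.
rewrite ler_wpM2l //; apply: le_trans (_ : \sum_(0 <= l < n.+1) K * rt n ^+ m.+1 * p l <= _).
  rewrite big_nat [leRHS]big_nat; apply: ler_sum => l /andP[_ ln].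
  apply: le_trans (hK l) _; rewrite ler_wpM2r ?pn_ge0 // ler_wpM2l //.
  by rewrite lerXn2r ?nnegrE // ler_sqrt // ler_nat -ltnS.
rewrite -mulr_sumr -/(psum R n.+1) psumS -mulrA ler_wpM2l //.
rewrite mulrCA ler_wpM2l ?exprn_ge0 //.
have := hY n; have := pn_ge0 R n; move: (p n) (rt n) r1 => q r r1 q0 h.
have : 0 <= (r - 1) * q by rewrite mulr_ge0 // subr_ge0.
rewrite mulrDl mulrDl; lra.
Qed.

(** As [k * j ^ m.+1 <= (k * j) ^ m.+1], the inner sum is at most [k^-1] times the full weighted
    sum. Only one logarithm arises, that of [hodd]. *)
Lemma sum_powers_le m n :
  \sum_(i < n) \sum_(1 <= j < n.+1) j%:R ^+ m.+1 * lag p n (i.*2.+1 * j)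
  <= hodd R n * psum_moment m.+1 n.
Proof.
rewrite /hodd mulr_suml; apply: ler_sum => i _.
have k0 : 0 < i.*2.+1%:R :> R by rewrite ltr0n.
rewrite ler_pdivlMl // mulr_sumr.
pose h s : R := s%:R ^+ m.+1 * lag p n s.
have h0 s : 0 <= h s by rewrite mulr_ge0 ?exprn_ge0 // lag_ge0 // => ?; exact: pn_ge0.
apply: le_trans (_ : \sum_(1 <= j < n.+1) h (i.*2.+1 * j)%N <= _).
  apply: ler_sum => j _; rewrite /h natrM mulrA ler_wpM2r ?lag_ge0 //.
  rewrite exprMn ler_wpM2r ?exprn_ge0 // exprS ler_peMr ?(ltW k0) //.
  by rewrite exprn_ege1 // ler1n.
apply: le_trans (sum_multiples_le _ _ h0) _ => //.
rewrite (@sum_support _ h n) ?leq_pmull //; last first.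
  by move=> s ns; rewrite /h lag_supp ?mulr0.
by rewrite /h (sum_lag (fun s => s%:R ^+ m.+1)).
Qed.

Lemma scale_ndec : {homo scale : a b / (a <= b)%N >-> a <= b}.
Proof.
move=> a b ab; have [->|a0] := posnP a.
  rewrite /scale sqrtr0 mul0r; have [->|b0] := posnP b; first by rewrite sqrtr0 mul0r.
  by rewrite mulr_ge0 // ln_ge0 // ler1n.
by rewrite ler_pM ?ln_ge0 ?ler1n ?ler_sqrt ?ler_nat // ler_ln ?posrE ?ltr0n ?ler_nat //; lia.
Qed.

(** The lags reach down to small arguments, where the eventual bound says nothing; there the trivial
    [oddsum_le] suffices because [scale n] tends to infinity. *)
Lemma oddsum_le_uniform m (C : R) : 0 < C ->
  (\forall n \near \oo, oddsum R m.+1 n <= C * scale n ^+ m.+1 * p n) ->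
  \forall n \near \oo, forall n', (n' <= n)%N ->
    oddsum R m.+1 n' <= C * scale n ^+ m.+1 * p n'.
Proof.
move=> C0 [N _ hN]; near=> n => n' n'n.
have r1 : 1 <= rt n by near: n; exact: sqrt_nat_dvg.
have l1 : 1 <= lg n by near: n; exact: ln_nat_dvg.
have g1 : 1 <= scale n by rewrite mulr_ege1.
have [Nn'|n'N] := leqP N n'.
  apply: le_trans (hN _ Nn') _; rewrite ler_wpM2r ?pn_ge0 // ler_wpM2l ?(ltW C0) //.
  have g'0 : 0 <= scale n'.
    by apply: le_trans (scale_ndec (leq0n n')); rewrite /scale sqrtr0 mul0r.
  by rewrite lerXn2r ?nnegrE ?scale_ndec // (le_trans ler01).
apply: le_trans (oddsum_le R m.+1 n') _; rewrite ler_wpM2r ?pn_ge0 //.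
apply: le_trans (_ : N%:R ^+ m.+1 <= _).
  by rewrite lerXn2r ?nnegrE // ler_nat ltnW.
rewrite mulrC -ler_pdivrMr //; apply: le_trans (_ : scale n <= _).
  apply: le_trans (_ : rt n <= _); last by rewrite ler_peMr // (le_trans ler01).
  by near: n; exact: sqrt_nat_dvg.
by rewrite exprS ler_peMr ?(le_trans ler01) // exprn_ege1.
Unshelve. all: by end_near. Qed.

Local Notation kappa := ((4 * c)^-1).

Lemma kappa_gt0 : 0 < kappa.
Proof. by rewrite invr_gt0 mulr_gt0 // sqrtr_gt0 zeta2_limit_gt0. Qed.

(** Continuity at [t = 0], sampled along the harmonic sequence. The slacks belong to [oddsum_step],
    the induction hypothesis, the first moment and the powers of [j], in this order. *)
Lemma choose_slack m (C : R) : kappa ^+ m.+1 < C ->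
  exists2 t : R, 0 < t &
    (1 + t) ^+ m * (kappa ^+ m + t) * (kappa + t) + t <= C.
Proof.
move=> kC; pose u n : R := n.+1%:R^-1.
have u0 : u n @[n --> \oo] --> (0 : R) by exact: cvg_harmonic.
have cst (a : R) : a + u n @[n --> \oo] --> a.
  by rewrite -[X in _ --> X]addr0; apply: cvgD => //; exact: cvg_cst.
have h : (1 + u n) ^+ m * (kappa ^+ m + u n) * (kappa + u n) + u n
    @[n --> \oo] --> kappa ^+ m.+1.
  have -> : kappa ^+ m.+1 = 1 ^+ m * kappa ^+ m * kappa + 0.
    by rewrite expr1n mul1r addr0 exprSr.
  apply: cvgD => //; apply: cvgM => //; apply: cvgM => //.
  exact: cvg_exprn.
have [n hn] := filter_ex (cvgr_le _ h _ kC).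
by exists (u n); rewrite ?invr_gt0.
Qed.

Lemma oddsum_upper m (C : R) : kappa ^+ m.+1 < C ->
  \forall n \near \oo, oddsum R m.+1 n <= C * scale n ^+ m.+1 * p n.
Proof.
have k0 := kappa_gt0.
have scale_pos : \forall n \near \oo, 0 < scale n.
  near=> n.
  have r1 : 1 <= rt n by near: n; exact: sqrt_nat_dvg.
  have l1 : 1 <= lg n by near: n; exact: ln_nat_dvg.
  by apply: lt_le_trans (mulr_ege1 r1 l1).
have base (C1 : R) : kappa < C1 ->
    \forall n \near \oo, oddsum R 1 n <= C1 * scale n * p n.
  move=> kC; near=> n.
  have g0 : 0 < scale n by near: n.
  rewrite -ler_pdivrMr ?pn_gt0 // -ler_pdivrMr //.
  by near: n; exact: cvgr_le _ oddsum1_cvg _ kC.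
elim: m C => [|m IH] C kC; first by rewrite expr1 in kC *; exact: base.
have [t t0 ht] := choose_slack kC.
have hm : \forall n \near \oo, forall n', (n' <= n)%N ->
    oddsum R m.+1 n' <= (kappa ^+ m.+1 + t) * scale n ^+ m.+1 * p n'.
  by apply: oddsum_le_uniform; [rewrite addr_gt0 // exprn_gt0|apply: IH; rewrite ltrDl].
have h1 := base (kappa + t); rewrite ltrDl in h1.
have {}h1 := h1 t0.
have [K K0 hK] := psum_moment_bound m.+1.
pose D : R := (1 + t^-1) ^+ m.+1.
have D0 : 0 < D by rewrite exprn_gt0 // addr_gt0 // invr_gt0.
near=> n.
have n0 : (0 < n)%N by near: n; exists 1%N.
have p0 := pn_gt0 R n.
have g0 : 0 < scale n by near: n.
have r0 : 0 < rt n by rewrite sqrtr_gt0 ltr0n.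
have l1 : 1 <= lg n by near: n; exact: ln_nat_dvg.
have l0 : 0 < lg n by exact: lt_le_trans l1.
have lK : D * 3 * K / t <= lg n by near: n; exact: ln_nat_dvg.
have hmn : forall n', (n' <= n)%N ->
    oddsum R m.+1 n' <= (kappa ^+ m.+1 + t) * scale n ^+ m.+1 * p n' by near: n.
have h1n : oddsum R 1 n <= (kappa + t) * scale n * p n by near: n.
apply: le_trans (oddsum_step m.+1 n t0) _.
(* The uniform bound leaves only [p] under the lag, so the double sum that remains is
   [oddsum R 1 n]. *)
have main : \sum_(i < n) \sum_(1 <= j < n.+1) lag (oddsum R m.+1) n (i.*2.+1 * j)
    <= (kappa ^+ m.+1 + t) * scale n ^+ m.+1 * ((kappa + t) * scale n * p n).
  have kt0 : 0 <= (kappa ^+ m.+1 + t) * scale n ^+ m.+1.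
    by rewrite mulr_ge0 ?exprn_ge0 ?addr_ge0 ?exprn_ge0 // ltW.
  apply: le_trans (ler_wpM2l kt0 h1n); rewrite oddsum1 mulr_sumr.
  apply: ler_sum => i _; rewrite mulr_sumr; apply: ler_sum => j _.
  by rewrite /lag; case: ifP => _; [rewrite hmn // leq_subr|rewrite mulr0].
(* The sum has order [lg n * rt n ^+ m.+2 * p n], short of the target by [lg n ^+ m.+1], which
   outgrows the constant [D * 3 * K / t]. *)
have rest : D * \sum_(i < n) \sum_(1 <= j < n.+1) j%:R ^+ m.+1 * lag p n (i.*2.+1 * j)
    <= t * scale n ^+ m.+2 * p n.
  apply: le_trans (_ : D * (3 * lg n * (K * rt n ^+ m.+2 * p n)) <= _).
    rewrite ler_wpM2l ?(ltW D0) //; apply: le_trans (sum_powers_le m n) _.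
    apply: ler_pM => //.
    - by apply: sumr_ge0 => i _; rewrite invr_ge0.
    - by apply: sumr_ge0 => i _; rewrite mulr_ge0 ?exprn_ge0 ?pn_ge0.
    apply: le_trans (hodd_le n) _.
    have : ln n.*2.+1%:R <= ln (3 * n%:R : R).
      have n1 : 1 <= n%:R :> R by rewrite ler1n.
      have nR0 : 0 < n%:R :> R by rewrite ltr0n.
      rewrite ler_ln ?posrE; [|by rewrite ltr0n|exact: mulr_gt0].
      by rewrite -addnn -natr1 natrD; lra.
    by rewrite lnM ?posrE ?ltr0n //; have := ln3_le; lra.
  rewrite /scale exprMn.
  have : D * 3 * K <= t * lg n ^+ m.+1.
    rewrite -ler_pdivrMl // mulrC; apply: le_trans lK _.
    by rewrite exprS ler_peMr ?(ltW l0) // exprn_ege1.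
  have q0 : 0 <= lg n * rt n ^+ m.+2 * p n.
    by rewrite mulr_ge0 ?(ltW p0) // mulr_ge0 ?exprn_ge0 ?(ltW l0).
  by move=> /(ler_wpM2r q0); congr (_ <= _); rewrite ?[lg n ^+ m.+2]exprS; ring.
apply: le_trans (lerD (ler_wpM2l _ main) rest) _.
  by rewrite exprn_ge0 // addr_ge0 // ltW.
have g1 : 0 <= scale n ^+ m.+2 * p n by rewrite mulr_ge0 ?exprn_ge0 // ltW.
by have := ler_wpM2r g1 ht; congr (_ <= _); rewrite [scale n ^+ m.+2]exprS; ring.
Unshelve. all: by end_near. Qed.

Lemma moment_cvg m : altsum_moment R m.+1 n / scale n ^+ m.+1 @[n --> \oo]
  --> kappa ^+ m.+1.
Proof.
apply/cvgrPdist_le => e e0.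
have lowcvg : (oddsum R 1 n / p n / scale n) ^+ m.+1 @[n --> \oo] --> kappa ^+ m.+1.
  exact/cvg_exprn/oddsum1_cvg.
have low : \forall n \near \oo,
    kappa ^+ m.+1 - e <= (oddsum R 1 n / p n / scale n) ^+ m.+1.
  by apply: (cvgr_ge _ lowcvg); rewrite ltrBlDr ltrDl.
have up : \forall n \near \oo,
    oddsum R m.+1 n <= (kappa ^+ m.+1 + e) * scale n ^+ m.+1 * p n.
  by apply: oddsum_upper; rewrite ltrDl.
near=> n.
have r1 : 1 <= rt n by near: n; exact: sqrt_nat_dvg.
have l1 : 1 <= lg n by near: n; exact: ln_nat_dvg.
have g0 : 0 < scale n by apply: lt_le_trans (mulr_ege1 r1 l1).
have lo : kappa ^+ m.+1 - e <= altsum_moment R m.+1 n / scale n ^+ m.+1.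
  rewrite altsum_momentE.
  apply: le_trans (_ : (oddsum R 1 n / p n / scale n) ^+ m.+1 <= _); first by near: n.
  by rewrite expr_div_n ler_wpM2r ?oddsum_jensen // invr_ge0 exprn_ge0 // ltW.
have hi : altsum_moment R m.+1 n / scale n ^+ m.+1 <= kappa ^+ m.+1 + e.
  rewrite altsum_momentE ler_pdivrMr ?exprn_gt0 // ler_pdivrMr ?pn_gt0 //.
  by near: n.
by rewrite ler_norml; apply/andP; split; lra.
Unshelve. all: by end_near. Qed.

(** * Comparison with the closed form *)

Definition moment_target m n : R :=
  6 `^ (m%:R / 2) / (2 ^+ m * pi ^+ m) * n%:R `^ (m%:R / 2)
    * ln (Num.sqrt (6 * n%:R) / pi) ^+ m.

Lemma moment_target_cvg m : moment_target m n / scale n ^+ m @[n --> \oo] --> kappa ^+ m.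
Proof.
have pi0 := pi_gt0 R.
have s6 : 0 < Num.sqrt 6 :> R by rewrite sqrtr_gt0.
pose b : R := ln (Num.sqrt 6 / pi).
have pw (x : R) : 0 <= x -> x `^ (m%:R / 2) = Num.sqrt x ^+ m.
  by move=> x0; rewrite mulrC powRrM powR12_sqrt // powR_mulrn.
(* The logarithm in the target is [lg n / 2 + b]; after division by [lg n] the constant [b] is
   multiplied by [(lg n)^-1], whose limit is the 0 written here. *)
have kE : kappa = Num.sqrt 6 / (2 * pi) * (2^-1 + b * 0).
  rewrite mulr0 addr0 sqrtrM ?sqr_ge0 // sqrtr_sqr ger0_norm ?(ltW pi0) // sqrtrV //.
  by move: (@pi R) pi0 => q q0; field; rewrite !gt_eqF.
have h : (Num.sqrt 6 / (2 * pi) * (2^-1 + b * (lg n)^-1)) ^+ m @[n --> \oo] --> kappa ^+ m.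
  apply: cvg_exprn.
  rewrite kE; apply: cvgM; first exact: cvg_cst.
  apply: cvgD; first exact: cvg_cst.
  by apply: cvgM; [exact: cvg_cst|exact: invr_ln_cvg0].
apply: cvg_trans h; apply: near_eq_cvg; near=> n.
have n0 : (0 < n)%N by near: n; exists 1%N.
have r0 : 0 < rt n by rewrite sqrtr_gt0 ltr0n.
have l1 : 1 <= lg n by near: n; exact: ln_nat_dvg.
have l0 : 0 < lg n by exact: lt_le_trans l1.
rewrite /moment_target.
have -> : Num.sqrt (6 * n%:R) / pi = Num.sqrt 6 / pi * rt n.
  by rewrite sqrtrM // mulrAC.
rewrite !pw // lnM ?posrE ?divr_gt0 // -/b ln_sqrt //.
rewrite -exprMn -expr_div_n -!exprMn /scale -expr_div_n; congr (_ ^+ _).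
move: (@pi R) pi0 => q q0; field.
by rewrite !gt_eqF.
Unshelve. all: by end_near. Qed.

End Moments.

Theorem theorem1p2 (R : realType) (m : nat) (hm : (1 <= m)%N) :
  asymp_equiv (fun n : nat => altsum_moment R m n)
    (fun n : nat =>
       6 `^ (m%:R / 2) / (2 ^+ m * pi ^+ m) * n%:R `^ (m%:R / 2)
         * ln (Num.sqrt (6 * n%:R) / pi) ^+ m).
Proof.
case: m hm => // m _; rewrite /asymp_equiv.
have k0 : (4 * Num.sqrt (@pi R ^+ 2 / 6))^-1 ^+ m.+1 != 0.
  by rewrite expf_neq0 // gt_eqF // kappa_gt0.
(* Moment and target have the same nonzero limit relative to [scale R n ^+ m.+1], so their quotient
   tends to 1. *)
have h : altsum_moment R m.+1 n / scale R n ^+ m.+1 *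
    (moment_target R m.+1 n / scale R n ^+ m.+1)^-1 @[n --> \oo] -->
    (4 * Num.sqrt (@pi R ^+ 2 / 6))^-1 ^+ m.+1 / (4 * Num.sqrt (@pi R ^+ 2 / 6))^-1 ^+ m.+1.
  by apply: cvgM; [exact: moment_cvg|apply: cvgV => //; exact: moment_target_cvg].
rewrite mulfV // in h; apply: cvg_trans h; apply: near_eq_cvg; near=> n.
have r1 : 1 <= Num.sqrt n%:R :> R by near: n; exact: sqrt_nat_dvg.
have l1 : 1 <= ln n%:R :> R by near: n; exact: ln_nat_dvg.
have g0 : scale R n ^+ m.+1 != 0.
  by rewrite expf_neq0 // gt_eqF // (lt_le_trans _ (mulr_ege1 r1 l1)).
by rewrite invf_div mulrA divfK.
Unshelve. all: by end_near. Qed.
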